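(* Let $m\ge 1$, let $M$ be a compact complex Hermitian manifold with metric $E_M$, let $\varphi:[0,\infty)\to(0,\infty)$ be an admissible weight, and let $f:\mathbb{C}^m\to M$ be a holomorphic mapping. Then $f\notin\mathcal{Y}_{\varphi}(\mathbb{C}^m,M)$ if and only if there exist sequences $\{z_j\},\{\xi_j\}\subset\mathbb{C}^m$ and $\{\rho_j\}\subset(0,1)$ with $\|z_j\|\to\infty$, $\rho_j\to 0$ and $\|\xi_j\|=1$ such that the sequence $$g_j(\zeta):=f(z_j+\rho_j\varphi(\|z_j\|)\xi_j\zeta)$$ converges uniformly on compact subsets of $\mathbb{C}$ to a non-constant holomorphic mapping $g:\mathbb{C}\to M$.
   Context: Admissible weight: a positive function $\varphi:[0,\infty)\to(0,\infty)$ such that, with $$\gamma_r:=\sup_{r\le a<b}\left|\frac{\varphi(a)-\varphi(b)}{a-b}\right|,$$ there is a constant $C\in(0,1]$ with $\gamma_r\le C$ for all $r\in(0,\infty)$, and $\lim_{r\to\infty}\gamma_r=0$. Metric: for a complex manifold $M$ with Hermitian metric $ds_M^2=\sum_{i,j}h_{ij}(p)\,dz_i\,d\bar z_j$ in local coordinates, $E_M(p,\xi)=(ds_M^2(\xi,\bar\xi))^{1/2}$ is the length of the tangent vector $\xi\in T_p(M)$ at $p$. $\|\cdot\|$ is the Euclidean norm on $\mathbb{C}^m$. Weighted Yosida mappings: a holomorphic mapping $f:\mathbb{C}^m\to M$ belongs to $\mathcal{Y}_{\varphi}(\mathbb{C}^m,M)$ if $$\limsup_{\|z\|\to\infty,\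 \|\xi\|=1}\varphi(\|z\|)\,E_M(f(z),df(z)(\xi))<\infty,$$ where $df(z):T_z(\mathbb{C}^m)\to T_{f(z)}(M)$ is the differential of $f$ and $\xi$ ranges over unit vectors of $\mathbb{C}^m$. *)

(* Defs.v *)
From HB Require Import structures.
From mathcomp Require Import all_boot all_order all_algebra complex.
From mathcomp Require Import all_classical all_reals all_analysis.
Set Implicit Arguments.
Unset Strict Implicit.
Unset Printing Implicit Defensive.
Import Order.TTheory GRing.Theory Num.Theory numFieldNormedType.Exports.
Local Open Scope classical_set_scope.
Local Open Scope ring_scope.

(* The library puts a topology and a norm on (R[i])^o only. *)
HB.instance Definition _ (R : realType) := NormedModule.copy R[i] (R[i])^o.

(* The library norm and topology on 'rV[R[i]]_n come from the sup norm; the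
   Euclidean norm induces the same topology but has to be defined. *)
Definition enorm (R : realType) (n : nat) (z : 'rV[R[i]]_n) : R :=
  Num.sqrt (\sum_(k < n) (complex.Re (z 0 k) ^+ 2 + complex.Im (z 0 k) ^+ 2)).

(* A complex-valued function of class C^k, in the real sense, on an open set
   of C^n: t below is a real parameter. *)
Fixpoint class_C (R : realType) (n k : nat) (V : set 'rV[R[i]]_n)
    (g : 'rV[R[i]]_n -> R[i]) : Prop :=
  (forall x, V x -> g y @[y --> x] --> g x) /\
  if k is k'.+1 then
    forall v : 'rV[R[i]]_n, exists2 g' : 'rV[R[i]]_n -> R[i],
      class_C k' V g' &
      forall x, V x ->
        ((t^-1)%:C%C * (g (x + t%:C%C *: v) - g x) : R[i])
          @[t --> (0 : R)^'] --> g' x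
  else True.

Definition smooth_on (R : realType) (n : nat) (V : set 'rV[R[i]]_n)
    (g : 'rV[R[i]]_n -> R[i]) : Prop :=
  forall k, class_C k V g.

(* [cmap] and [cinv] are total functions, meaningful only on [cdom] and [ccod]
   respectively. *)
Record chart (R : realType) (n : nat) (M : topologicalType) := Chart {
  cdom : set M;
  ccod : set 'rV[R[i]]_n;
  cmap :> M -> 'rV[R[i]]_n;
  cinv : 'rV[R[i]]_n -> M;
  cdom_open : open cdom;
  ccod_open : open ccod;
  cmap_cod : forall p, cdom p -> ccod (cmap p);
  cinv_dom : forall x, ccod x -> cdom (cinv x);
  cmapK : forall p, cdom p -> cinv (cmap p) = p;
  cinvK : forall x, ccod x -> cmap (cinv x) = x;
  cmap_continuous : forall p, cdom p -> cmap q @[q --> p] --> cmap p;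
  cinv_continuous : forall x, ccod x -> cinv y @[y --> x] --> cinv x }.

(* Holomorphy is Frechet differentiability over R[i] at every point. *)
Record complex_manifold (R : realType) (n : nat) (M : topologicalType) :=
  ComplexManifold {
  atlas : set (chart R n M);
  manifold_hausdorff : hausdorff_space M;
  manifold_second_countable : @second_countable M;
  atlas_cover : forall p : M, exists c, atlas c /\ cdom c p;
  atlas_holomorphic : forall c d, atlas c -> atlas d ->
    forall x, ccod c x -> cdom d (cinv c x) ->
      differentiable (d \o cinv c) x }.

Definition charts_at (R : realType) (n : nat) (M : topologicalType)
    (X : complex_manifold R n M) (p : M) :=
  {c : chart R n M | atlas X c /\ cdom c p}.

(* A (holomorphic) tangent vector at p is a coordinate vector in each chart
   at p, subject to the change-of-coordinates rule. *)
Record tangent (R : realType) (n : nat) (M : topologicalType)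
    (X : complex_manifold R n M) (p : M) := Tangent {
  tcoord :> charts_at X p -> 'rV[R[i]]_n;
  tcoordP : forall c d : charts_at X p,
    tcoord d = 'd (sval d \o cinv (sval c)) (sval c p) (tcoord c) }.

(* \sum_(i, j) h_ij v_i conj(w_j) *)
Definition hform (R : realType) (n : nat) (h : 'M[R[i]]_n)
    (v w : 'rV[R[i]]_n) : R[i] :=
  \sum_(i < n) \sum_(j < n) h i j * v 0 i * (w 0 j)^*.

(* [hmx c p] is the matrix (h_ij(p)) of ds^2 in the coordinates of the chart c;
   it is meaningful only for c in the atlas and p in the domain of c. *)
Record hermitian_metric (R : realType) (n : nat) (M : topologicalType)
    (X : complex_manifold R n M) := HermitianMetric {
  hmx : chart R n M -> M -> 'M[R[i]]_n;
  hmx_hermitian : forall c p, atlas X c -> cdom c p ->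
    forall i j, hmx c p j i = (hmx c p i j)^*;
  hmx_posdef : forall c p, atlas X c -> cdom c p ->
    forall v, v != 0 -> 0 < hform (hmx c p) v v;
  hmx_smooth : forall c, atlas X c ->
    forall i j, smooth_on (ccod c) (fun x => hmx c (cinv c x) i j);
  hmx_compat : forall c d p, atlas X c -> atlas X d -> cdom c p -> cdom d p ->
    forall v w : 'rV[R[i]]_n,
      hform (hmx c p) v w =
      hform (hmx d p) ('d (d \o cinv c) (c p) v) ('d (d \o cinv c) (c p) w) }.

Definition chart_at (R : realType) (n : nat) (M : topologicalType)
    (X : complex_manifold R n M) (p : M) : charts_at X p :=
  cid (atlas_cover X p).

(* E_M(p, v); by [tangent_lengthE] the choice of the chart is irrelevant. *)
Definition tangent_length (R : realType) (n : nat) (M : topologicalType)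
    (X : complex_manifold R n M) (h : hermitian_metric X) (p : M)
    (v : tangent X p) : R :=
  let c := chart_at X p in
  Num.sqrt (complex.Re (hform (hmx h (sval c) p) (v c) (v c))).

Lemma tangent_lengthE (R : realType) (n : nat) (M : topologicalType)
    (X : complex_manifold R n M) (h : hermitian_metric X) (p : M)
    (v : tangent X p) (c : charts_at X p) :
  tangent_length h v =
  Num.sqrt (complex.Re (hform (hmx h (sval c) p) (v c) (v c))).
Proof.
rewrite /tangent_length; have [ac dc] := svalP c.
have [ac0 dc0] := svalP (chart_at X p).
by rewrite (hmx_compat h ac0 ac dc0 dc) -!tcoordP.
Qed.

Record holomap (R : realType) (n : nat) (V : normedModType R[i])
    (M : topologicalType) (X : complex_manifold R n M) := Holomap {
  hfun :> V -> M;
  hfun_continuous : continuous hfun;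
  hfun_holomorphic : forall z c, atlas X c -> cdom c (hfun z) ->
    differentiable (c \o hfun) z }.

Lemma near_eq_diff (K : numFieldType) (V W : normedModType K) (f g : V -> W)
    (x : V) : differentiable g x -> (\forall y \near x, f y = g y) ->
  'd f x = 'd g x :> (V -> W).
Proof.
move=> dg fg; apply: diff_unique; first exact: diff_continuous.
apply/eqaddoP => e e0.
have /eqaddoP /(_ e e0) := diff_locally dg.
have fgx : f x = g x by exact: nbhs_singleton fg.
have fg0 : \forall y \near (0 : V), f (y + x) = g (y + x).
  by move: fg; rewrite (near_shift 0) subr0.
apply: filterS2 fg0 => y fgy.
by rewrite /= !fctE /= fgx fgy.
Qed.

Section Differential.
Variables (R : realType) (n : nat) (V : normedModType R[i]).
Variables (M : topologicalType) (X : complex_manifold R n M).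
Variables (f : holomap V X) (z xi : V).

Definition differential_coord (c : charts_at X (f z)) : 'rV[R[i]]_n :=
  'd (sval c \o f) z xi.

Lemma differential_coordP (c d : charts_at X (f z)) :
  differential_coord d =
  'd (sval d \o cinv (sval c)) (sval c (f z)) (differential_coord c).
Proof.
have [ac dc] := svalP c; have [ad dd] := svalP d; rewrite /differential_coord.
have cK := cmapK dc.
have df := hfun_holomorphic ac dc.
have dt : differentiable (sval d \o cinv (sval c)) (sval c (f z)).
  by apply: (atlas_holomorphic ac ad); [exact: cmap_cod|rewrite cK].
have fcd : \forall x \near z,
    (sval d \o f) x = ((sval d \o cinv (sval c)) \o (sval c \o f)) x.
  have : \forall x \near z, cdom (sval c) (f x).
    apply: (@hfun_continuous _ _ _ _ _ f z).
    exact: open_nbhs_nbhs (conj (cdom_open (sval c)) dc).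
  by apply: filterS => x /= dx; rewrite cmapK.
have dgf := differentiable_comp df dt.
have e1 := near_eq_diff dgf fcd.
have e2 := diff_comp df dt.
exact: (etrans (congr1 (@^~ xi) e1) (congr1 (@^~ xi) e2)).
Qed.

Definition differential : tangent X (f z) := Tangent differential_coordP.

End Differential.

(* Only the values of phi on [0, +oo[ matter; the supremum is taken in the
   extended reals. *)
Definition weight_gamma (R : realType) (phi : R -> R) (r : R) : \bar R :=
  ereal_sup [set (`|(phi ab.1 - phi ab.2) / (ab.1 - ab.2)|)%:E
            | ab in [set ab : R * R | r <= ab.1 /\ ab.1 < ab.2]].

Definition admissible_weight (R : realType) (phi : R -> R) : Prop :=
  [/\ forall r, 0 <= r -> 0 < phi r,
      exists C : R, [/\ 0 < C, C <= 1 &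
        forall r, 0 < r -> (weight_gamma phi r <= C%:E)%E] &
      weight_gamma phi r @[r --> +oo] --> (0 : \bar R)%E].

(* The filter "||z|| -> oo, ||xi|| = 1" on pairs (z, xi). *)
Definition infty_sphere (R : realType) (m : nat) :
    set_system ('rV[R[i]]_m * 'rV[R[i]]_m) :=
  filter_from [set: R]
    (fun A => [set zx | A <= enorm zx.1 /\ enorm zx.2 = 1]).

Definition yosida (R : realType) (m n : nat) (M : topologicalType)
    (X : complex_manifold R n M) (h : hermitian_metric X) (phi : R -> R) :
    set (holomap 'rV[R[i]]_m X) :=
  [set f | (limf_esup
     (fun zx => (phi (enorm zx.1) *
                 tangent_length h (differential f zx.1 zx.2))%:E)
     (@infty_sphere R m) < +oo)%E].

(* Main.v *)
Require Import Defs.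
From HB Require Import structures.
From mathcomp Require Import all_boot all_order all_algebra complex.
From mathcomp Require Import all_classical all_reals all_analysis.
From mathcomp Require Import ring lra.
Import Order.TTheory GRing.Theory Num.Theory numFieldNormedType.Exports.
Set Implicit Arguments.
Unset Strict Implicit.
Unset Printing Implicit Defensive.
Local Open Scope classical_set_scope.
Local Open Scope ring_scope.

(** If the maps g_j converge locally uniformly and f is a Yosida map, then the
    weight phi varies little on the discs of radius rho_j * phi, so the speeds of
    the g_j tend to 0 and the limit is constant.

    Conversely, if f is not a Yosida map, take points z'_j where
    phi(|z'_j|) * |df(xi_j)| tends to infinity and apply Brody's point picking on
    the disc of radius 1/2 of the curve zeta |-> f(z'_j + phi(|z'_j|) zeta xi_j).
    After recentring, the rescaled curves have speed 1 at 0 and speed at most 4 on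
    discs of radius tending to infinity.  Bounded speed makes them equicontinuous,
    so compactness of M gives a convergent subsequence; its limit is holomorphic
    by Weierstrass' theorem in charts, with speed limit 1 at 0.

    The one-variable facts needed (local boundedness of derivatives and
    Weierstrass' theorem) all follow from a Cauchy estimate, which is proved
    without assuming derivatives continuous and without the exponential map:
    Goursat's bisection argument is applied to (f(z) - f(0) - f'(0) z) / z^2 on a
    square with a small square around 0 removed. *)

(** * Goursat's lemma for closed one-forms *)

(** The radius 1/2 is tied to the bound [C <= 1]: it makes [phi] 1-Lipschitz, so moving by at most
    half the weight leaves at least half the weight. Hence the scale can be normalised by the weight
    at the new centre, and, since [phi] grows at most linearly, the new centres still tend to
    infinity.

    The Cauchy estimate never evaluates the integral of dz/z. Only Im(F dz) is integrated; once a
    rotation has made f'(0) real and nonnegative, the term -f'(0)/z has the favourable sign on each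
    side of the outer square, and pointwise bounds suffice.

    M has no global coordinates, so estimates uniform in j need a disc of known radius on which the
    curves stay in one chart. Such a disc comes from a continuity argument along segments: a slow
    curve cannot cross a coordinate ball. This confinement serves three times: for equicontinuity,
    for Weierstrass' theorem, and, at speed zero, for constancy of the limit.

    Compactness of a product of copies of M gives only cluster points; second countability of M and
    a countable dense set of parameters turn one into the limit of a subsequence. *)

Section primitives.
Variable R : realType.
Implicit Types (a b c d t x y al be e : R) (u U : R -> R) (P Q : R -> R -> R).

(** Differentiability is asked only inside the interval, with continuity up to the ends: this is
    what the fundamental theorem of calculus yields and what the mean value theorem consumes. *)
Definition primitive u a b U :=
  {within `[a, b], continuous U} /\ forall t, a < t < b -> is_derive t 1 U (u t).

Lemma primitive_exists u a b :
  (forall t, a <= t <= b -> {for t, continuous u}) -> exists U, primitive u a b U.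
Proof.
have [ab|ba] := ltP a b; last first.
  exists (fun=> 0); split; first by apply: continuous_subspaceT => x; exact: cst_continuous.
  by move=> t /andP[at_ tb]; have := lt_le_trans (lt_trans at_ tb) ba; rewrite ltxx.
move=> cu.
have cu' : {within `[a, b], continuous u}.
  apply: continuous_in_subspaceT => x; rewrite inE/= in_itv/=; exact: cu.
have iu : (@lebesgue_measure R).-integrable `[a, b] (EFin \o u).
  by apply: continuous_compact_integrable => //; exact: segment_compact.
pose U x := parameterized_integral (@lebesgue_measure R) a x u.
have dU t : a < t < b -> is_derive t 1 U (u t).
  move=> /andP[at_ tb].
  have [d e] : derivable U t 1 /\ derive1 U t = u t.
    by apply: (continuous_FTC1_closed tb iu at_); apply: cu; rewrite !ltW.
  by apply: DeriveDef; [exact: d|rewrite -derive1E e].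
exists U; split; last exact: dU.
exact: parameterized_integral_continuous (ltW ab) iu.
Qed.

Lemma primitiveS u a b c d U : a <= c -> d <= b ->
  primitive u a b U -> primitive u c d U.
Proof.
move=> ac db [cU dU]; split.
  apply: continuous_subspaceW cU => x /=; rewrite !in_itv/= => /andP[cx xd].
  by rewrite (le_trans ac cx) (le_trans xd db).
move=> t /andP[ct td]; apply: dU.
by rewrite (le_lt_trans ac ct) (lt_le_trans td db).
Qed.

Lemma primitive_MVT u a b U : a <= b -> primitive u a b U ->
  exists2 c, a <= c <= b & U b - U a = u c * (b - a).
Proof.
move=> ab [cU dU].
have dU' x : x \in `]a, b[ -> is_derive x 1 U (u x) by rewrite in_itv/=; exact: dU.
by have [c + e] := MVT_segment ab dU' cU; rewrite in_itv/= => ?; exists c.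
Qed.

(** The mean value theorem, applied to [U] minus a primitive of the affine function, gives the error
    exactly; no integrals are compared. *)
Lemma primitive_affine u a b U al be e : a <= b -> primitive u a b U ->
  (forall t, a <= t <= b -> `|u t - al - be * t| <= e) ->
  `|U b - U a - (al * (b - a) + be * ((b ^+ 2 - a ^+ 2) / 2))| <= e * (b - a).
Proof.
move=> ab [cU dU] ue.
pose W t := U t - (al * t + be * (t ^+ 2 / 2)).
have [|c cab] := @primitive_MVT (fun t => u t - al - be * t) a b W ab.
  split.
    move=> x; apply: cvgB; first exact: cU.
    have cc : continuous (fun t : R => al * t + be * (t ^+ 2 / 2)).
      move=> y; apply: cvgD; apply: cvgM; [exact: cvg_cst|exact: cvg_id|exact: cvg_cst|].
      by apply: cvgM; [exact: exprn_continuous|exact: cvg_cst].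
    exact: (continuous_subspaceT cc).
  move=> t /dU dUt; rewrite /W.
  have dq : is_derive t 1 (fun t : R => al * t + be * (t ^+ 2 / 2)) (al + be * t).
    have -> : (fun t : R => al * t + be * (t ^+ 2 / 2)) =
      (horner (al *: 'X + (be / 2) *: 'X^2)).
      by apply/funext => s; rewrite hornerD !hornerZ hornerX hornerXn; field.
    apply: is_derive_eq; rewrite derivD !derivZ derivX derivXn hornerD !hornerZ hornerC.
    by rewrite hornerMn hornerXn /=; field.
  by apply: is_derive_eq; rewrite opprD addrA.
rewrite {1}/W => e1.
have -> : U b - U a - (al * (b - a) + be * ((b ^+ 2 - a ^+ 2) / 2)) =
   (u c - al - be * c) * (b - a).
  by rewrite -e1 /W; field.
by rewrite normrM (ger0_norm (_ : 0 <= b - a)) ?subr_ge0// ler_wpM2r ?subr_ge0// ue.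
Qed.

End primitives.

Section goursat.
Variable R : realType.
Implicit Types (a b c d t x y al be e : R) (u U : R -> R) (P Q : R -> R -> R).

(* P dx + Q dy is differentiable and closed at (x0, y0): the derivative of P in y
   and that of Q in x are the same b. *)
Definition closed_at P Q x0 y0 := exists a b c, forall e, 0 < e ->
  exists2 d, 0 < d & forall x y, `|x - x0| <= d -> `|y - y0| <= d ->
  `|P x y - P x0 y0 - a * (x - x0) - b * (y - y0)| <= e * (`|x - x0| + `|y - y0|) /\
  `|Q x y - Q x0 y0 - b * (x - x0) - c * (y - y0)| <= e * (`|x - x0| + `|y - y0|).

(* The contour integral of P dx + Q dy along the boundary of a rectangle, where
   [H y] is a primitive of P(., y) and [V x] one of Q(x, .). *)
Definition circ (H V : R -> R -> R) x1 x2 y1 y2 :=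
  (H y1 x2 - H y1 x1) + (V x2 y2 - V x2 y1)
  - (H y2 x2 - H y2 x1) - (V x1 y2 - V x1 y1).

(** The affine parts of [P] and [Q] have zero circulation because both cross coefficients are [b].
    The remainder is at most [e * (w + h)] on each side, and the perimeter is [2 * (w + h)]. *)
Lemma circ_le P Q H V x1 x2 y1 y2 x0 y0 a b c e :
  x1 <= x0 <= x2 -> y1 <= y0 <= y2 -> 0 <= e ->
  (forall y, y1 <= y <= y2 -> primitive (P^~ y) x1 x2 (H y)) ->
  (forall x, x1 <= x <= x2 -> primitive (Q x) y1 y2 (V x)) ->
  (forall x y, x1 <= x <= x2 -> y1 <= y <= y2 ->
    `|P x y - P x0 y0 - a * (x - x0) - b * (y - y0)| <= e * (`|x - x0| + `|y - y0|) /\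
    `|Q x y - Q x0 y0 - b * (x - x0) - c * (y - y0)| <= e * (`|x - x0| + `|y - y0|)) ->
  `|circ H V x1 x2 y1 y2| <= 2 * e * (x2 - x1 + (y2 - y1)) ^+ 2.
Proof.
move=> /andP[x10 x02] /andP[y10 y02] e0 pH pV PQ.
have x12 : x1 <= x2 by lra.
have y12 : y1 <= y2 by lra.
set w := x2 - x1; set h := y2 - y1.
have le_wh x y : x1 <= x <= x2 -> y1 <= y <= y2 ->
    e * (`|x - x0| + `|y - y0|) <= e * (w + h).
  move=> /andP[? ?] /andP[? ?]; rewrite ler_wpM2l// lerD// ler_norml /w /h; lra.
have bH y : y1 <= y <= y2 ->
  `|H y x2 - H y x1 - ((P x0 y0 - a * x0 + b * (y - y0)) * (x2 - x1)
      + a * ((x2 ^+ 2 - x1 ^+ 2) / 2))| <= e * (w + h) * (x2 - x1).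
  move=> yb; apply: (primitive_affine x12 (pH y yb)) => t tb.
  have [p _] := PQ t y tb yb; apply: le_trans (le_wh t y tb yb); apply: le_trans p.
  by rewrite le_eqVlt; apply/orP; left; apply/eqP; congr (`|_|); ring.
have bV x : x1 <= x <= x2 ->
  `|V x y2 - V x y1 - ((Q x0 y0 - c * y0 + b * (x - x0)) * (y2 - y1)
      + c * ((y2 ^+ 2 - y1 ^+ 2) / 2))| <= e * (w + h) * (y2 - y1).
  move=> xb; apply: (primitive_affine y12 (pV x xb)) => t tb.
  have [_ p] := PQ x t xb tb; apply: le_trans (le_wh x t xb tb); apply: le_trans p.
  by rewrite le_eqVlt; apply/orP; left; apply/eqP; congr (`|_|); ring.
have y1b : y1 <= y1 <= y2 by rewrite lexx.
have y2b : y1 <= y2 <= y2 by rewrite lexx andbT.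
have x1b : x1 <= x1 <= x2 by rewrite lexx.
have x2b : x1 <= x2 <= x2 by rewrite lexx andbT.
move: (bH _ y1b) (bH _ y2b) (bV _ x1b) (bV _ x2b).
set A1 := (X in `|_ - X| <= _ -> _ -> _ -> _ -> _).
set A2 := (X in _ -> `|_ - X| <= _ -> _ -> _ -> _).
set A3 := (X in _ -> _ -> `|_ - X| <= _ -> _ -> _).
set A4 := (X in _ -> _ -> _ -> `|_ - X| <= _ -> _).
have A0 : A1 + A4 - A2 - A3 = 0 by rewrite /A1 /A2 /A3 /A4; field.
clearbody A1 A2 A3 A4.
have -> : 2 * e * (w + h) ^+ 2 = 2 * (e * (w + h) * w) + 2 * (e * (w + h) * h) by ring.
rewrite /circ !ler_norml -/w -/h; move: (e * _ * w) (e * _ * h) => W K.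
move=> /andP[? ?] /andP[? ?] /andP[? ?] /andP[? ?]; lra.
Qed.

Lemma nested_corner (X : nat -> R) w :
  (forall k, X k <= X k.+1) ->
  (forall k, X k.+1 + w / 2 ^+ k.+1 <= X k + w / 2 ^+ k) -> 0 <= w ->
  exists l, forall k, X k <= l <= X k + w / 2 ^+ k.
Proof.
move=> Xi Xd w0.
have mX : {homo X : m n / (m <= n)%N >-> m <= n}.
  by apply: homo_leq => //; exact: le_trans.
have ub m k : X m <= X k + w / 2 ^+ k.
  have h n : X n <= X n + w / 2 ^+ n by rewrite lerDl divr_ge0// exprn_ge0.
  have mY : {homo (fun n => X n + w / 2 ^+ n) : m n / (m <= n)%N >-> m >= n}.
    by apply: homo_leq => // x y z p q; exact: le_trans q p.
  have [mk|/ltnW km] := leqP m k; first exact: le_trans (mX _ _ mk) (h k).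
  exact: le_trans (h m) (mY _ _ km).
have hs : has_sup (range X).
  by split; [exists (X 0%N), 0%N|exists (X 0%N + w / 2 ^+ 0) => _ [m _ <-]].
exists (sup (range X)) => k; apply/andP; split.
  by apply: (ub_le_sup hs.2); exists k.
by apply: (ge_sup hs.1) => _ [m _ <-].
Qed.

(** Of four quarters one carries at least a quarter of the circulation. At the point common to the
    nested rectangles, the quadratic bound of [circ_le] cancels [4 ^+ k] and leaves an arbitrarily
    small factor. With primitives fixed on all lines, additivity under subdivision is an algebraic
    identity. *)
Theorem goursat P Q H V x1 x2 y1 y2 : x1 < x2 -> y1 < y2 ->
  (forall y, y1 <= y <= y2 -> primitive (P^~ y) x1 x2 (H y)) ->
  (forall x, x1 <= x <= x2 -> primitive (Q x) y1 y2 (V x)) ->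
  (forall x y, x1 <= x <= x2 -> y1 <= y <= y2 -> closed_at P Q x y) ->
  circ H V x1 x2 y1 y2 = 0.
Proof.
move=> x12 y12 pH pV cPQ; apply/eqP/negPn/negP; rewrite -normr_gt0 => c0.
pose w := x2 - x1; pose h := y2 - y1.
have w0 : 0 < w by rewrite subr_gt0.
have h0 : 0 < h by rewrite subr_gt0.
pose C (k : nat) (p : R * R) :=
  circ H V p.1 (p.1 + w / 2 ^+ k) p.2 (p.2 + h / 2 ^+ k).
pose inside (k : nat) (p : R * R) := [/\ x1 <= p.1, p.1 + w / 2 ^+ k <= x2,
  y1 <= p.2 & p.2 + h / 2 ^+ k <= y2].
pose bad (k : nat) (p : R * R) := inside k p /\ C 0%N (x1, y1) != 0 /\
  `|C 0%N (x1, y1)| <= 4 ^+ k * `|C k p|.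
(* [bad] is placed under the existential so that choice yields a total successor function, arbitrary
   on other arguments. *)
have step (kp : nat * (R * R)) : exists q : R * R, bad kp.1 kp.2 ->
    bad kp.1.+1 q /\ [/\ kp.2.1 <= q.1, q.1 + w / 2 ^+ kp.1.+1 <= kp.2.1 + w / 2 ^+ kp.1,
     kp.2.2 <= q.2 & q.2 + h / 2 ^+ kp.1.+1 <= kp.2.2 + h / 2 ^+ kp.1].
  case: kp => k [x y] /=.
  have [[[/= i1 i2 i3 i4] [n0 Cb]]|nb] := pselect (bad k (x, y)); last by exists (0, 0) => /nb.
  pose w' := w / 2 ^+ k.+1; pose h' := h / 2 ^+ k.+1.
  have w'0 : 0 < w' by rewrite divr_gt0// exprn_gt0.
  have h'0 : 0 < h' by rewrite divr_gt0// exprn_gt0.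
  have k0 : (2 ^+ k : R) != 0 by rewrite expf_neq0.
  have wE : w / 2 ^+ k = w' + w' by rewrite /w' exprS; field.
  have hE : h / 2 ^+ k = h' + h' by rewrite /h' exprS; field.
  have CE : C k (x, y) = C k.+1 (x, y) + C k.+1 (x + w', y) +
      C k.+1 (x, y + h') + C k.+1 (x + w', y + h').
    by rewrite /C /= wE hE -/w' -/h' /circ !addrA; ring.
  have [q [qx qy] Cq] : exists2 q : R * R,
      (q.1 = x \/ q.1 = x + w') /\ (q.2 = y \/ q.2 = y + h') &
      `|C k (x, y)| <= 4 * `|C k.+1 q|.
    rewrite CE.
    set c1 := C _ (x, y); set c2 := C _ (x + w', y).
    set c3 := C _ (x, y + h'); set c4 := C _ (x + w', y + h').
    have N : `|c1 + c2 + c3 + c4| <= `|c1| + `|c2| + `|c3| + `|c4|.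
      apply: le_trans (ler_normD _ _) _; rewrite lerD2r.
      by apply: le_trans (ler_normD _ _) _; rewrite lerD2r ler_normD.
    set n := `|c1 + _ + _ + _| in N *.
    have [?|?] := leP n (4 * `|c1|); first by exists (x, y) => //=; split; left.
    have [?|?] := leP n (4 * `|c2|).
      by exists (x + w', y) => //=; split; [right|left].
    have [?|?] := leP n (4 * `|c3|).
      by exists (x, y + h') => //=; split; [left|right].
    exists (x + w', y + h') => //=; first by split; right.
    rewrite -/c4; lra.
  exists q => _; rewrite wE hE -/w' -/h'.
  rewrite wE in i2; rewrite hE in i4.
  split; last by clear -qx qy w'0 h'0; case: qx => ->; case: qy => ->; split; lra.
  split.
    rewrite /inside -/w' -/h'; clear -qx qy w'0 h'0 i1 i2 i3 i4.
    by case: qx => ->; case: qy => ->; split; lra.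
  split=> //; apply: le_trans Cb _.
  by rewrite exprSr -mulrA ler_wpM2l// exprn_ge0.
have [s sP] := choice step.
pose q := fix q k := if k is k'.+1 then s (k', q k') else (x1, y1).
have bq k : bad k (q k).
  elim: k => [|k bk]; last by have [] := sP (k, q k) bk.
  split; first by rewrite /inside /= !expr0 !divr1 /w /h; split; lra.
  split; last by rewrite expr0 mul1r.
  by rewrite /C /= expr0 !divr1 /w /h !subrKC -normr_gt0.
have qS k := (sP (k, q k) (bq k)).2.
have [x0 x0P] : exists l, forall k, (q k).1 <= l <= (q k).1 + w / 2 ^+ k.
  by apply: nested_corner (ltW w0) => k; case: (qS k).
have [y0 y0P] : exists l, forall k, (q k).2 <= l <= (q k).2 + h / 2 ^+ k.
  by apply: nested_corner (ltW h0) => k; case: (qS k).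
have x0b : x1 <= x0 <= x2.
  by have := x0P 0%N; rewrite /= expr0 divr1 /w subrKC.
have y0b : y1 <= y0 <= y2.
  by have := y0P 0%N; rewrite /= expr0 divr1 /h subrKC.
have [a [b [c PQ]]] := cPQ _ _ x0b y0b.
have C00 : 0 < `|C 0%N (x1, y1)| by rewrite normr_gt0 (bq 0%N).2.1.
(* With this value the bound at stage [k], multiplied by [4 ^+ k], is exactly half the initial
   circulation. *)
pose e := `|C 0%N (x1, y1)| / (4 * (w + h) ^+ 2).
have wh0 : 0 < w + h by rewrite addr_gt0.
have e0 : 0 < e by rewrite divr_gt0// mulr_gt0// exprn_gt0.
have [d d0 PQd] := PQ e e0.
have [k kd] : exists k, (w + h) / 2 ^+ k <= d.
  have B0 : 0 <= (w + h) / d by rewrite divr_ge0// ltW.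
  exists (Num.bound ((w + h) / d)); rewrite ler_pdivrMr ?exprn_gt0//.
  rewrite mulrC -ler_pdivrMr//; apply: le_trans (ltW (archi_boundP B0)) _.
  by rewrite -natrX ler_nat ltnW// ltn_expl.
have [[i1 i2 i3 i4] [_ Cb]] := bq k.
have k0 : (2 ^+ k : R) != 0 by rewrite expf_neq0.
have wk0 : 0 < w / 2 ^+ k by rewrite divr_gt0// exprn_gt0.
have hk0 : 0 < h / 2 ^+ k by rewrite divr_gt0// exprn_gt0.
have : `|C k (q k)| <= 2 * e * (w / 2 ^+ k + h / 2 ^+ k) ^+ 2.
  have /andP[xa xb] := x0P k; have /andP[ya yb] := y0P k.
  rewrite /C.
  have -> : w / 2 ^+ k + h / 2 ^+ k = (q k).1 + w / 2 ^+ k - (q k).1 +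
    ((q k).2 + h / 2 ^+ k - (q k).2) by ring.
  apply: (circ_le (P := P) (Q := Q) (x0 := x0) (y0 := y0) (a := a) (b := b) (c := c)).
  - by rewrite xa.
  - by rewrite ya.
  - exact: ltW.
  - move=> y /andP[y1' y2']; apply: primitiveS (pH y _) => //.
    by rewrite (le_trans i3 y1') (le_trans y2' i4).
  - move=> x /andP[x1' x2']; apply: primitiveS (pV x _) => //.
    by rewrite (le_trans i1 x1') (le_trans x2' i2).
  - rewrite mulrDl in kd; move=> x y /andP[x1' x2'] /andP[y1' y2'].
    apply: PQd; rewrite ler_norml; move: (q k) xa xb ya yb x1' x2' y1' y2' kd hk0 wk0 => z.
      clear; move: (w / _) (h / _) => *; lra.
    clear; move: (w / _) (h / _) => *; lra.
rewrite -mulrDl exprMn => Cle.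
have : `|C 0%N (x1, y1)| <= `|C 0%N (x1, y1)| / 2.
  apply: le_trans Cb _.
  have -> : `|C 0%N (x1, y1)| / 2 = 4 ^+ k * (2 * e * ((w + h) ^+ 2 * (2 ^+ k)^-1 ^+ 2)).
    have -> : (4 : R) = 2 ^+ 2 by ring.
    rewrite /e -exprM mulnC exprM; field.
    by rewrite k0 lt0r_neq0.
  by rewrite ler_wpM2l// exprn_ge0.
lra.
Qed.

End goursat.

(** * Circulation around a square with a hole *)

Section annulus.
Variable R : realType.
Implicit Types (a b c d t x y al be e : R) (u U : R -> R) (P Q : R -> R -> R).

Lemma closed_at_continuous P Q x y : closed_at P Q x y ->
  {for x, continuous (P^~ y)} /\ {for y, continuous (Q x)}.
Proof.
move=> [a [b [c PQ]]].
have key (g : R -> R) (s k : R) : (forall e, 0 < e -> exists2 d, 0 < d & forall t,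
    `|t - s| <= d -> `|g t - g s - k * (t - s)| <= e * `|t - s|) -> {for s, continuous g}.
  move=> h; apply/cvgrPdist_le => /= e e0.
  have [d d0 hd] := h 1 ltr01.
  have m0 : 0 < Num.min d (e / (1 + `|k|)).
    by rewrite lt_min d0 divr_gt0// ltr_pwDl.
  near=> t.
  have : `|s - t| <= Num.min d (e / (1 + `|k|)) by near: t; exact: cvgr_dist_le.
  rewrite distrC le_min => /andP[/hd h1]; rewrite ler_pdivlMr ?ltr_pwDl// => h2.
  rewrite distrC; apply: le_trans h2.
  have -> : g t - g s = (g t - g s - k * (t - s)) + k * (t - s) by ring.
  apply: le_trans (ler_normD _ _) _; rewrite normrM; lra.
split.
  apply: (key _ _ a) => e e0; have [d d0 h] := PQ e e0; exists d => // t td.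
  have yd : `|y - y| <= d by rewrite subrr normr0 ltW.
  by have [+ _] := h t y td yd; rewrite subrr normr0 mulr0 subr0 addr0.
apply: (key _ _ c) => e e0; have [d d0 h] := PQ e e0; exists d => // t td.
have xd : `|x - x| <= d by rewrite subrr normr0 ltW.
by have [_ +] := h x t xd td; rewrite subrr normr0 mulr0 subr0 add0r.
Unshelve. all: by end_near. Qed.

Lemma primitive_unique u a b U W : a <= b -> primitive u a b U -> primitive u a b W ->
  U b - U a = W b - W a.
Proof.
move=> ab [cU dU] [cW dW].
have pUW : primitive (fun=> 0) a b (fun t => U t - W t).
  split; first by move=> x; apply: cvgB; [exact: cU|exact: cW].
  move=> t tab; have du := dU t tab; have dw := dW t tab.
  by apply: is_derive_eq; rewrite subrr.
have [c _] := primitive_MVT ab pUW; rewrite mul0r => e.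
by apply/eqP; rewrite -subr_eq0 -e; apply/eqP; ring.
Qed.

(** Around a singularity at 0, primitives along the whole width of the large square exist only off
    the axes, yet a strip beside the hole is crossed by an axis. So primitives are required on the
    four sides only; those on inner lines are built here and agree on the sides by uniqueness. *)
Lemma goursat_boundary P Q H V x1 x2 y1 y2 : x1 < x2 -> y1 < y2 ->
  primitive (P^~ y1) x1 x2 (H y1) -> primitive (P^~ y2) x1 x2 (H y2) ->
  primitive (Q x1) y1 y2 (V x1) -> primitive (Q x2) y1 y2 (V x2) ->
  (forall x y, x1 <= x <= x2 -> y1 <= y <= y2 -> closed_at P Q x y) ->
  circ H V x1 x2 y1 y2 = 0.
Proof.
move=> x12 y12 pH1 pH2 pV1 pV2 cPQ.
have /choice[H' HP] (y : R) : exists U, y1 <= y <= y2 -> primitive (P^~ y) x1 x2 U.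
  have [yb|n] := pselect (y1 <= y <= y2); last by exists (fun=> 0).
  have [U pU] : exists U, primitive (P^~ y) x1 x2 U.
    by apply: primitive_exists => t tr; exact: (closed_at_continuous (cPQ t y tr yb)).1.
  by exists U.
have /choice[V' VP] (x : R) : exists U, x1 <= x <= x2 -> primitive (Q x) y1 y2 U.
  have [xb|n] := pselect (x1 <= x <= x2); last by exists (fun=> 0).
  have [U pU] : exists U, primitive (Q x) y1 y2 U.
    by apply: primitive_exists => t tr; exact: (closed_at_continuous (cPQ x t xb tr)).2.
  by exists U.
have y1b : y1 <= y1 <= y2 by rewrite lexx ltW.
have y2b : y1 <= y2 <= y2 by rewrite lexx ltW.
have x1b : x1 <= x1 <= x2 by rewrite lexx ltW.
have x2b : x1 <= x2 <= x2 by rewrite lexx ltW.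
rewrite -(goursat x12 y12 HP VP cPQ) /circ.
rewrite (primitive_unique (ltW x12) pH1 (HP _ y1b)).
rewrite (primitive_unique (ltW x12) pH2 (HP _ y2b)).
rewrite (primitive_unique (ltW y12) pV1 (VP _ x1b)).
by rewrite (primitive_unique (ltW y12) pV2 (VP _ x2b)).
Qed.

(* The integral over the large square equals the one over the small square, which
   is at most 8 e by the second hypothesis; the third bounds the former by 8 r k. *)
Lemma annulus_estimate P Q r k : 0 < r ->
  (forall x y, `|x| <= r -> `|y| <= r -> (x != 0) || (y != 0) -> closed_at P Q x y) ->
  (forall e, 0 < e -> exists2 d, 0 < d < r & forall t, `|t| <= d ->
    [/\ `|P t d| <= e / d, `|P t (- d)| <= e / d,
        `|Q d t| <= e / d & `|Q (- d) t| <= e / d]) ->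
  (forall t, `|t| <= r -> [/\ Q r t <= k, - k <= Q (- r) t,
     P t (- r) <= k & - k <= P t r]) ->
  0 <= k.
Proof.
move=> r0 cPQ sing bd.
have /choice[H HP] (y : R) : exists U, `|y| <= r -> y != 0 -> primitive (P^~ y) (- r) r U.
  have [[yr y0]|n] := pselect (`|y| <= r /\ y != 0); last first.
    by exists (fun=> 0) => yr y0; exfalso; apply: n.
  have [U pU] : exists U, primitive (P^~ y) (- r) r U.
    apply: primitive_exists => t; rewrite -ler_norml => tr.
    by apply: (closed_at_continuous (cPQ t y tr yr _)).1; rewrite y0 orbT.
  by exists U.
have /choice[V VP] (x : R) : exists U, `|x| <= r -> x != 0 -> primitive (Q x) (- r) r U.
  have [[yr y0]|n] := pselect (`|x| <= r /\ x != 0); last first.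
    by exists (fun=> 0) => yr y0; exfalso; apply: n.
  have [U pU] : exists U, primitive (Q x) (- r) r U.
    apply: primitive_exists => t; rewrite -ler_norml => tr.
    by apply: (closed_at_continuous (cPQ x t yr tr _)).2; rewrite y0.
  by exists U.
have HPS x1 x2 y : - r <= x1 -> x2 <= r -> `|y| <= r -> y != 0 ->
    primitive (P^~ y) x1 x2 (H y).
  by move=> x1r x2r yr y0; apply: primitiveS (HP _ yr y0).
have VPS y1 y2 x : - r <= y1 -> y2 <= r -> `|x| <= r -> x != 0 ->
    primitive (Q x) y1 y2 (V x).
  by move=> x1r x2r yr y0; apply: primitiveS (VP _ yr y0).
have nn d : 0 < d -> d < r -> [/\ d != 0, - d != 0, `|d| <= r & `|- d| <= r].
  by move=> d0 dr; rewrite normrN gtr0_norm// oppr_eq0 gt_eqF// ltW.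
have rect x1 x2 y1 y2 : x1 < x2 -> y1 < y2 -> - r <= x1 -> x2 <= r ->
    - r <= y1 -> y2 <= r -> x1 != 0 -> x2 != 0 -> y1 != 0 -> y2 != 0 ->
    (0 < x1 \/ x2 < 0) \/ (0 < y1 \/ y2 < 0) ->
    circ H V x1 x2 y1 y2 = 0.
  move=> x12 y12 rx1 x2r ry1 y2r x10 x20 y10 y20 far.
  have [X1 X2 Y1 Y2] : [/\ `|x1| <= r, `|x2| <= r, `|y1| <= r & `|y2| <= r].
    by clear -x12 y12 rx1 x2r ry1 y2r; split; rewrite ler_norml; lra.
  apply: (goursat_boundary (P := P) (Q := Q)); rewrite //; [exact: HPS..|exact: VPS|exact: VPS|].
  move=> x y /andP[xa xb] /andP[ya yb]; apply: cPQ.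
  - clear -xa xb rx1 x2r; rewrite ler_norml; lra.
  - clear -ya yb ry1 y2r; rewrite ler_norml; lra.
  - clear -far xa xb ya yb; apply/negPn/negP; rewrite negb_or !negbK.
    by move=> /andP[/eqP x0 /eqP y0]; rewrite x0 y0 in xa xb ya yb; lra.
have main e : 0 < e -> 0 <= 8 * r * k + 8 * e.
  move=> e0; have [d /andP[d0 dr] sd] := sing e e0.
  have [dn0 dnn0 _ _] := nn d d0 dr.
  have [rn0 rnn0] : r != 0 /\ - r != 0 by rewrite oppr_eq0 gt_eqF.
  (* The square without its hole is cut into two full-height strips, left and right, and two blocks,
     below and above the hole. *)
  have E : circ H V (- r) r (- r) r = circ H V (- d) d (- d) d.
    have e1 : circ H V (- r) (- d) (- r) r = 0 by apply: rect; rewrite //; clear -d0 dr; lra.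
    have e2 : circ H V d r (- r) r = 0 by apply: rect; rewrite //; clear -d0 dr; lra.
    have e3 : circ H V (- d) d (- r) (- d) = 0 by apply: rect; rewrite //; clear -d0 dr; lra.
    have e4 : circ H V (- d) d d r = 0 by apply: rect; rewrite //; clear -d0 dr; lra.
    have := congr2 +%R (congr2 +%R e1 e2) (congr2 +%R e3 e4).
    rewrite !addr0 /circ => e5; apply/eqP; rewrite -subr_eq0 -{}e5.
    by apply/eqP; ring.
  have hs x1 x2 y : x1 < x2 -> - r <= x1 -> x2 <= r -> `|y| <= r -> y != 0 ->
      exists2 t, x1 <= t <= x2 & H y x2 - H y x1 = P t y * (x2 - x1).
    by move=> x12 ? ? ? ?; apply: (primitive_MVT (ltW x12)); apply: HPS.
  have vs y1 y2 x : y1 < y2 -> - r <= y1 -> y2 <= r -> `|x| <= r -> x != 0 ->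
      exists2 t, y1 <= t <= y2 & V x y2 - V x y1 = Q x t * (y2 - y1).
    by move=> y12 ? ? ? ?; apply: (primitive_MVT (ltW y12)); apply: VPS.
  have nr : `|r| <= r by rewrite gtr0_norm.
  have nnr : `|- r| <= r by rewrite normrN gtr0_norm.
  have nd : `|d| <= r by rewrite gtr0_norm// ltW.
  have nnd : `|- d| <= r by rewrite normrN gtr0_norm// ltW.
  have small : - (8 * e) <= circ H V (- d) d (- d) d.
    have b1 x : - d <= x <= d -> `|x| <= d by rewrite ler_norml.
    have [t1 /b1/sd[_ p1 _ _] e1] : exists2 t, - d <= t <= d &
        H (- d) d - H (- d) (- d) = P t (- d) * (d - - d).
      by apply: hs; rewrite //; clear -d0 dr r0; lra.
    have [t2 /b1/sd[p2 _ _ _] e2] : exists2 t, - d <= t <= d &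
        H d d - H d (- d) = P t d * (d - - d).
      by apply: hs; rewrite //; clear -d0 dr r0; lra.
    have [t3 /b1/sd[_ _ p3 _] e3] : exists2 t, - d <= t <= d &
        V d d - V d (- d) = Q d t * (d - - d).
      by apply: vs; rewrite //; clear -d0 dr r0; lra.
    have [t4 /b1/sd[_ _ _ p4] e4] : exists2 t, - d <= t <= d &
        V (- d) d - V (- d) (- d) = Q (- d) t * (d - - d).
      by apply: vs; rewrite //; clear -d0 dr r0; lra.
    rewrite /circ e1 e2 e3 e4; move: p1 p2 p3 p4; rewrite !ler_pdivlMr//.
    have md (p q : R) : `|p| * d <= q -> - q <= p * d <= q.
      by move=> pq; rewrite -ler_norml normrM (gtr0_norm d0).
    clear -md; move=> /md/andP[? ?] /md/andP[? ?] /md/andP[? ?] /md/andP[? ?]; lra.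
  have big : circ H V (- r) r (- r) r <= 8 * r * k.
    have b1 x : - r <= x <= r -> `|x| <= r by rewrite ler_norml.
    have [t1 /b1/bd[_ _ p1 _] e1] : exists2 t, - r <= t <= r &
        H (- r) r - H (- r) (- r) = P t (- r) * (r - - r).
      by apply: hs; rewrite //; clear -d0 dr r0; lra.
    have [t2 /b1/bd[_ _ _ p2] e2] : exists2 t, - r <= t <= r &
        H r r - H r (- r) = P t r * (r - - r).
      by apply: hs; rewrite //; clear -d0 dr r0; lra.
    have [t3 /b1/bd[p3 _ _ _] e3] : exists2 t, - r <= t <= r &
        V r r - V r (- r) = Q r t * (r - - r).
      by apply: vs; rewrite //; clear -d0 dr r0; lra.
    have [t4 /b1/bd[_ p4 _ _] e4] : exists2 t, - r <= t <= r &
        V (- r) r - V (- r) (- r) = Q (- r) t * (r - - r).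
      by apply: vs; rewrite //; clear -d0 dr r0; lra.
    rewrite /circ e1 e2 e3 e4.
    have rr : 0 <= r - - r by lra.
    move: (ler_wpM2r rr p1) (ler_wpM2r rr p2) (ler_wpM2r rr p3) (ler_wpM2r rr p4); clear; lra.
  rewrite E in big; clear -small big; lra.
rewrite leNgt; apply/negP => k0.
(* For [k < 0] this choice turns the inequality into [0 <= 4 * r * k]. *)
have := main (- (r * k) / 2).
have rk : r * k < 0 by rewrite pmulr_rlt0.
clear -rk => /(_ ltac:(lra)); lra.
Qed.

End annulus.

(** * Holomorphic functions of one variable *)

Section nrm.
Variable R : realType.
Implicit Types (V : normedModType R[i]).

(** The norm of a normed module over [R[i]] takes values in [R[i]]; its real part is the same number
    in the ordered field [R], where linear arithmetic applies. *)
Definition nrm V (v : V) : R := complex.Re `|v|.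

Lemma nrmE V (v : V) : `|v| = (nrm v)%:C%C.
Proof. by rewrite /nrm RRe_real// ger0_real. Qed.

Lemma nrm_ge0 V (v : V) : 0 <= nrm v.
Proof. by rewrite -ler0c -nrmE. Qed.

Lemma nrm0 V : nrm (0 : V) = 0.
Proof. by rewrite /nrm normr0. Qed.

Lemma nrm0_eq0 V (v : V) : nrm v = 0 -> v = 0.
Proof. by move=> v0; apply/normr0_eq0; rewrite nrmE v0. Qed.

Lemma nrmN V (v : V) : nrm (- v) = nrm v.
Proof. by rewrite /nrm normrN. Qed.

Lemma nrmBC V (v w : V) : nrm (v - w) = nrm (w - v).
Proof. by rewrite /nrm distrC. Qed.

Lemma nrmD V (v w : V) : nrm (v + w) <= nrm v + nrm w.
Proof. by rewrite -lecR rmorphD/= -!nrmE ler_normD. Qed.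

Lemma nrmB V (v w : V) : nrm (v - w) <= nrm v + nrm w.
Proof. by rewrite -(nrmN w) nrmD. Qed.

Lemma nrm_trans V (u v w : V) : nrm (u - w) <= nrm (u - v) + nrm (v - w).
Proof. by apply: le_trans (nrmD _ _); rewrite addrA subrK. Qed.

Lemma nrmZ V (a : R[i]) (v : V) : nrm (a *: v) = nrm a * nrm v.
Proof.
by apply: (@complexI R); rewrite rmorphM/= -!nrmE normrZ.
Qed.

Lemma nrmM (a b : R[i]) : nrm (a * b) = nrm a * nrm b.
Proof. by apply: (@complexI R); rewrite rmorphM/= -!nrmE normrM. Qed.

Lemma nrmV (a : R[i]) : nrm a^-1 = (nrm a)^-1.
Proof. by apply: (@complexI R); rewrite fmorphV/= -!nrmE normfV. Qed.

Lemma nrm_real (t : R) : nrm (t%:C%C : R[i]) = `|t|.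
Proof. by rewrite /nrm normc_def/= expr0n/= addr0 sqrtr_sqr. Qed.

Lemma nrm1 : nrm (1 : R[i]) = 1.
Proof. by rewrite /nrm normr1. Qed.

Lemma nrm_sqr (z : R[i]) : nrm z ^+ 2 = complex.Re z ^+ 2 + complex.Im z ^+ 2.
Proof. by rewrite /nrm normc_def/= sqr_sqrtr// addr_ge0// sqr_ge0. Qed.

Lemma Re_le_nrm (z : R[i]) : `|complex.Re z| <= nrm z.
Proof. by rewrite -lecR -nrmE normc_ge_Re. Qed.

Lemma Im_le_nrm (z : R[i]) : `|complex.Im z| <= nrm z.
Proof. 
rewrite -(ler_pXn2r (_ : 0 < 2)%N) ?nnegrE ?nrm_ge0// nrm_sqr real_normK ?num_real//.
by rewrite lerDr sqr_ge0.
Qed.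

Lemma nrm_le_ReIm (z : R[i]) : nrm z <= `|complex.Re z| + `|complex.Im z|.
Proof.
case: z => x y /=.
have -> : (x +i* y)%C = x%:C%C + 'i%C * y%:C%C by rewrite [LHS]complexE.
apply: le_trans (nrmD _ _) _; rewrite nrmM !nrm_real.
by rewrite [nrm 'i%C]/nrm normc_def/= expr0n/= expr1n add0r sqrtr1 mul1r.
Qed.

Lemma nbhs_nrmP V (x : V) (A : set V) :
  nbhs x A <-> exists2 e, 0 < e & forall y, nrm (y - x) < e -> A y.
Proof.
split=> [/nbhs_ballP[e /= e0 eA]|[e e0 eA]].
  have er : e \is Num.real by rewrite gtr0_real.
  exists (complex.Re e); first by rewrite -ltcR RRe_real.
  move=> y yx; apply: eA; rewrite -ball_normE /= distrC nrmE.
  by rewrite -(RRe_real er) ltcR.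
apply/nbhs_ballP; exists e%:C%C; first by rewrite /= ltcR.
move=> y; rewrite -ball_normE /= distrC nrmE ltcR; exact: eA.
Qed.

Lemma cvg_nrmP V (T : Type) (F : set_system T) (f : T -> V) (l : V) : Filter F ->
  (f @ F --> l <-> forall e, 0 < e -> \forall x \near F, nrm (f x - l) < e).
Proof.
move=> FF; split=> [fl e e0|fl A /nbhs_nrmP[e e0 eA]].
  by apply: (fl (fun y => nrm (y - l) < e)); apply/nbhs_nrmP; exists e.
by apply: filterS (fl e e0) => x; exact: eA.
Qed.

Lemma nrm_coord n (v : 'rV[R[i]]_n) k : nrm (v 0 k) <= nrm v.
Proof.
rewrite -lecR -!nrmE [leRHS]/Num.Def.normr/= mx_normE.
have h : `|v 0 k|%:nng%:num <= (\big[Order.max/0%:nng]_i `|v i.1 i.2|%:nng)%:num.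
  by rewrite num_le; apply/bigmax_geP; right; exists (0, k).
exact: h.
Qed.

Lemma nrm_rV_le n (v : 'rV[R[i]]_n) (B : R) : 0 <= B ->
  (forall k, nrm (v 0 k) <= B) -> nrm v <= B.
Proof.
move=> B0 vB; have [v0|] := eqVneq (mx_norm v) 0.
  by rewrite -lecR -nrmE [leLHS]/Num.Def.normr/= v0 ler0c.
move=> /mx_norm_neq0[[i k] e]; rewrite -lecR -nrmE [leLHS]/Num.Def.normr/= e.
by rewrite ord1 nrmE lecR.
Qed.

(** The complex derivative with explicit epsilon and delta in [R], so that constants can be tracked;
    [D] is the image of 1 under the differential. *)
Definition hasd V (w : R[i] -> V) (z : R[i]) (D : V) := forall e : R, 0 < e ->
  exists2 d : R, 0 < d & forall h, nrm h < d ->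
    nrm (w (z + h) - w z - h *: D) <= e * nrm h.

Lemma hasdP V (w : R[i] -> V) z D :
  hasd w z D <-> differentiable w z /\ 'd w z 1 = D.
Proof.
split.
  move=> wD.
  pose df (h : R[i]) := h *: D.
  have lin_df : linear df by move=> ? ? ?; rewrite /df scalerDl scalerA.
  pose dfM := GRing.isLinear.Build _ _ _ _ _ lin_df.
  pose dfL : {linear _ -> _} := HB.pack df dfM.
  have cL : continuous dfL by exact: scalel_continuous.
  have oL : w \o shift z = cst (w z) + dfL +o_ (0 : R[i]) id.
    apply/eqaddoP => e e0.
    have er : e \is Num.real by rewrite gtr0_real.
    have [|d d0 hd] := wD (complex.Re e); first by rewrite -ltcR RRe_real.
    apply/nbhs_nrmP; exists d => // h; rewrite subr0 => /hd.
    rewrite -lecR rmorphM/= -!nrmE (RRe_real er); apply: le_trans.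
    by rewrite !fctE /= opprD addrA [h + z]addrC.
  have dE := diff_unique cL oL.
  split; first by apply/diff_locallyP; rewrite dE.
  by rewrite dE /= /df scale1r.
move=> [dw <-] e e0.
have /diff_locally/eqaddoP/(_ e%:C%C) := dw.
rewrite ltcR => /(_ e0) /nbhs_nrmP[d d0 hd]; exists d => // h hd'.
have := hd h; rewrite subr0 => /(_ hd'); rewrite !fctE /=.
have <- : 'd w z h = h *: 'd w z 1 by rewrite -linearZ /= [h *: 1]mulr1.
by rewrite !nrmE -rmorphM/= lecR opprD addrA [h + z]addrC.
Qed.

End nrm.

(** * The Cauchy estimate at the centre of a square *)

Section cauchy.
Variable R : realType.
Implicit Types (z : R[i]) (f : R[i] -> R[i]).

(** The form is Im(f dz). By the Cauchy-Riemann equations both cross coefficients equal the real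
    part of [D]. *)
Lemma hasd_closed_at f (x y : R) (D : R[i]) : hasd f (Complex x y) D ->
  closed_at (fun x y => complex.Im (f (Complex x y))) (fun x y => complex.Re (f (Complex x y))) x y.
Proof.
move=> fD; exists (complex.Im D), (complex.Re D), (- complex.Im D) => e e0.
have [d d0 hd] := fD e e0.
exists (d / 4); first by rewrite divr_gt0.
move=> s t sx ty; pose h : R[i] := Complex (s - x) (t - y).
have hn : nrm h <= `|s - x| + `|t - y| by exact: nrm_le_ReIm.
have {hd} hd : nrm (f (Complex s t) - f (Complex x y) - h * D) <= e * (`|s - x| + `|t - y|).
  have -> : Complex s t = Complex x y + h.
    by apply/eqP; rewrite eq_complex /= !subrKC !eqxx.
  apply: le_trans (hd h _) _; last by rewrite ler_pM2l.
  by apply: le_lt_trans hn _; clear -sx ty d0; lra.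
split; apply: le_trans hd; [apply: le_trans (Im_le_nrm _)|apply: le_trans (Re_le_nrm _)].
  rewrite le_eqVlt; apply/orP; left; apply/eqP; congr (`|_|).
  case: (f _) => a b; case: (f _) => a' b'; case: (D) => p q /=; ring.
rewrite le_eqVlt; apply/orP; left; apply/eqP; congr (`|_|).
case: (f _) => a b; case: (f _) => a' b'; case: (D) => p q /=; ring.
Qed.

Lemma hasd_quotient f (d : R[i]) z D : z != 0 -> hasd f z D ->
  exists E, hasd (fun z => (f z - d * z) * z^-1 * z^-1) z E.
Proof.
move=> z0 /hasdP[df _].
suff dF : differentiable (fun z => (f z - d * z) * z^-1 * z^-1) z.
  by exists ('d (fun z => (f z - d * z) * z^-1 * z^-1) z 1); apply/hasdP.
have dV : differentiable (GRing.inv : R[i] -> R[i]) z by exact: differentiable_Rinv.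
have dl : differentiable (fun z => d * z : R[i]) z.
  apply: (proj1 ((hasdP _ _ d).1 _)) => e e0; exists 1 => // h _.
    have -> : d * (z + h) - d * z - h *: d = 0 :> R[i] by rewrite [h *: d]mulrC; ring.
    by rewrite nrm0; apply: mulr_ge0; [exact: ltW|exact: nrm_ge0].
exact: (differentiableM (differentiableM (differentiableB df dl) dV) dV).
Qed.

(** [F] is o(1/|z|) at 0, so the hole contributes arbitrarily little. On the outer square f/z^2 is
    at most [B / r ^+ 2], while -d/z lowers the outward component by at least [d / (2 * r)] on every
    side. The annulus estimate says that the difference of these two bounds is nonnegative. *)
Lemma cauchy_square0 f (d r B : R) : 0 < r -> f 0 = 0 -> hasd f 0 d%:C%C -> 0 <= d ->
  (forall z, `|complex.Re z| <= r -> `|complex.Im z| <= r ->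
    (exists D, hasd f z D) /\ nrm (f z) <= B) ->
  d <= 2 * B / r.
Proof.
move=> r0 f0 fd d0 fB.
pose F z := (f z - d%:C%C * z) * z^-1 * z^-1.
have ann : 0 <= B / r ^+ 2 - d / (2 * r).
  apply: (annulus_estimate (P := fun x y => complex.Im (F (Complex x y)))
     (Q := fun x y => complex.Re (F (Complex x y))) r0).
  - move=> x y xr yr xy; have [[E fE] _] := fB (Complex x y) xr yr.
    have [|G FG] := hasd_quotient d%:C%C _ fE.
      by rewrite eq_complex /= negb_and.
    exact: hasd_closed_at FG.
  - move=> e e0; have [t t0 ht] := fd e e0.
    (* [r / 2] keeps the hole inside the square; with [t / 4], the boundary of the hole, where |z|
       is at most twice the half-side, lies within the radius [t] of the derivative estimate. *)
    have m0 : 0 < Num.min (r / 2) (t / 4) by rewrite lt_min !divr_gt0.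
    exists (Num.min (r / 2) (t / 4)).
      by rewrite m0 gt_min; apply/orP; left; clear -r0; lra.
    have : Num.min (r / 2) (t / 4) <= t / 4 by rewrite ge_min lexx orbT.
    move: (Num.min _ _) m0 => m m0 mt s sm.
    have key z : m <= nrm z -> nrm z <= `|complex.Re z| + `|complex.Im z| ->
       `|complex.Re z| <= m -> `|complex.Im z| <= m -> nrm (F z) <= e / m.
      move=> zm zRI zR zI.
      have z0 : 0 < nrm z by apply: lt_le_trans zm.
      rewrite /F !nrmM !nrmV.
      have := ht z; rewrite add0r f0 subr0 [z *: _]mulrC => h.
      have {}h : nrm (f z - d%:C%C * z) <= e * nrm z.
        by apply: h; clear -zRI zR zI mt t0; lra.
      apply: (@le_trans _ _ (e / nrm z)).
        by rewrite ler_wpM2r ?invr_ge0 ?nrm_ge0// ler_pdivrMr.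
      by rewrite ler_wpM2l ?(ltW e0)// lef_pV2.
    have K a b : `|a| <= m -> `|b| <= m -> (`|a| = m \/ `|b| = m) ->
       nrm (F (Complex a b)) <= e / m.
      move=> am bm ab; apply: key => //=; last exact: nrm_le_ReIm.
      case: ab => <-; [exact: (Re_le_nrm (Complex a b))|exact: (Im_le_nrm (Complex a b))].
    have mm : `|m| = m by rewrite gtr0_norm.
    have mm' : `|- m| = m by rewrite normrN.
    split; [apply: le_trans (Im_le_nrm _) _|apply: le_trans (Im_le_nrm _) _|
       apply: le_trans (Re_le_nrm _) _|apply: le_trans (Re_le_nrm _) _];
      apply: K; rewrite ?mm ?mm' //; by [left|right].
  - move=> t tr.
    have key z : r <= nrm z -> `|complex.Re z| <= r -> `|complex.Im z| <= r ->
       exists2 G : R[i], F z = G - d%:C%C * z^-1 & nrm G <= B / r ^+ 2.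
      move=> zr zR zI; exists (f z * z^-1 * z^-1).
        have z0 : z != 0 by apply/negP => /eqP z0; move: zr; rewrite z0 nrm0 leNgt r0.
        by rewrite /F mulrBl mulfK// mulrBl.
      have [_ fzB] := fB z zR zI.
      have z0 : 0 < nrm z by apply: lt_le_trans zr.
      rewrite !nrmM !nrmV -mulrA -invfM ler_pM ?invr_ge0 ?mulr_ge0 ?nrm_ge0//.
      by rewrite lef_pV2 ?posrE ?mulr_gt0// ler_pM// ltW.
    have sq : 0 < r ^+ 2 + t ^+ 2 by rewrite ltr_wpDr ?sqr_ge0// exprn_gt0.
    have tr2 : t ^+ 2 <= r ^+ 2 by rewrite -real_normK ?num_real// lerXn2r ?nnegrE ?(ltW r0).
    (* On the outer sides |z|^2 is at most [2 * r ^+ 2]. *)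
    have kk : d / (2 * r) <= d * (r / (r ^+ 2 + t ^+ 2)).
      rewrite ler_wpM2l// ler_pdivlMr// mulrC ler_pdivrMr ?mulr_gt0//.
      by rewrite mulrCA -expr2; clear -tr2; lra.
    have nr : `|r| <= r by rewrite gtr0_norm.
    have nnr : `|- r| <= r by rewrite normrN gtr0_norm.
    have lr x y : `|x| <= r -> `|y| <= r -> x ^+ 2 = r ^+ 2 \/ y ^+ 2 = r ^+ 2 ->
      [/\ `|complex.Re (F (Complex x y)) + d * (x / (x ^+ 2 + y ^+ 2))| <= B / r ^+ 2 &
       `|complex.Im (F (Complex x y)) - d * (y / (x ^+ 2 + y ^+ 2))| <= B / r ^+ 2].
      move=> xr yr xy; have [|//|//|G FE GB] := key (Complex x y).
        rewrite -(ler_pXn2r (_ : 0 < 2)%N) ?nnegrE ?nrm_ge0 ?(ltW r0)// nrm_sqr /=.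
        by case: xy => ->; rewrite ?lerDl ?lerDr sqr_ge0.
      rewrite FE; split; apply: le_trans GB.
        apply: le_trans (Re_le_nrm _); rewrite le_eqVlt; apply/orP; left; apply/eqP; congr (`|_|).
        by case: (G) => a b /=; ring.
      apply: le_trans (Im_le_nrm _); rewrite le_eqVlt; apply/orP; left; apply/eqP; congr (`|_|).
      by case: (G) => a b /=; ring.
    have rr : (- r) ^+ 2 = r ^+ 2 by rewrite sqrrN.
    have [h1 _] := lr r t nr tr (or_introl erefl).
    have [h2 _] := lr (- r) t nnr tr (or_introl rr).
    have [_ h3] := lr t (- r) tr nnr (or_intror rr).
    have [_ h4] := lr t r tr nr (or_intror erefl).
    rewrite rr ?[t ^+ 2 + r ^+ 2]addrC !mulNr ?mulrN in h2 h3 h4.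
    move: h1 h2 h3 h4 kk; rewrite !ler_norml; move: (d * _) (d / _) (B / _); clear => p q s.
    move=> /andP[? ?] /andP[? ?] /andP[? ?] /andP[? ?] ?; split; lra.
move: ann; rewrite subr_ge0.
rewrite ler_pdivrMr ?mulr_gt0// => /le_trans; apply.
by rewrite le_eqVlt; apply/orP; left; apply/eqP; field; rewrite gt_eqF.
Qed.

End cauchy.

(** * Mean value inequality and second-order Taylor bound *)

Section taylor.
Variable R : realType.
Implicit Types (z h : R[i]) (f : R[i] -> R[i]) (e d r B L t : R).

Lemma hasd_unique (V : normedModType R[i]) (w : R[i] -> V) z D E :
  hasd w z D -> hasd w z E -> D = E.
Proof. by move=> /hasdP[_ <-] /hasdP[_ <-]. Qed.

Lemma hasdB (V : normedModType R[i]) (w v : R[i] -> V) z D E :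
  hasd w z D -> hasd v z E -> hasd (fun z => w z - v z) z (D - E).
Proof.
move=> wD vE e e0; have e20 : 0 < e / 2 by rewrite divr_gt0.
have [d d0 hd] := wD _ e20; have [d' d'0 hd'] := vE _ e20.
exists (Num.min d d'); first by rewrite lt_min d0.
move=> h; rewrite lt_min => /andP[/hd h1 /hd' h2].
have -> : w (z + h) - v (z + h) - (w z - v z) - h *: (D - E) =
    (w (z + h) - w z - h *: D) - (v (z + h) - v z - h *: E).
  by rewrite scalerBr !opprD !opprK -!addrA; congr (_ + _); rewrite addrC -!addrA;
     congr (_ + _); rewrite addrC -!addrA; congr (_ + _); rewrite addrCA; congr (_ + _); rewrite addrC.
by apply: le_trans (nrmB _ _) _; rewrite (splitr e) mulrDl lerD.
Qed.

Lemma hasd_lin (V : normedModType R[i]) (a : R[i]) (D : V) z :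
  hasd (fun z => (z - a) *: D) z D.
Proof.
move=> e e0; exists 1 => // h _.
rewrite -scalerBl -scalerBl (_ : z + h - a - (z - a) - h = 0); last by ring.
by rewrite scale0r nrm0; apply: mulr_ge0; [exact: ltW|exact: nrm_ge0].
Qed.

Lemma hasd_shift (V : normedModType R[i]) (w : R[i] -> V) a z D :
  hasd w (z + a) D -> hasd (fun z => w (z + a)) z D.
Proof.
move=> wD e e0; have [d d0 hd] := wD e e0; exists d => // h hd'.
by rewrite [z + h + a]addrAC; exact: hd.
Qed.

Lemma hasdZ (V : normedModType R[i]) (w : R[i] -> V) (a : R[i]) z D :
  hasd w z D -> hasd (fun z => a *: w z) z (a *: D).
Proof.
move=> wD e e0.
have a0 : 0 < nrm a + 1 by rewrite ltr_wpDl ?nrm_ge0.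
have [d d0 hd] := wD (e / (nrm a + 1)) (divr_gt0 e0 a0); exists d => // h /hd hh.
rewrite [h *: (a *: D)]scalerA mulrC -scalerA -!scalerBr nrmZ.
apply: (@le_trans _ _ ((nrm a + 1) * (e / (nrm a + 1) * nrm h))).
  by apply: ler_pM; rewrite ?nrm_ge0// lerDl.
by rewrite mulrA [_ * (e / _)]mulrC divfK// gt_eqF.
Qed.

Lemma hasd_cst (V : normedModType R[i]) (v : V) z : hasd (fun=> v) z 0.
Proof.
move=> e e0; exists 1 => // h _; rewrite scaler0 !subrr nrm0.
by apply: mulr_ge0; [exact: ltW|exact: nrm_ge0].
Qed.

Lemma hasd_coord n (w : R[i] -> 'rV[R[i]]_n) z D k :
  hasd w z D -> hasd (fun z => w z 0 k) z (D 0 k).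
Proof.
move=> wD e e0; have [d d0 hd] := wD e e0; exists d => // h /hd.
by apply: le_trans; apply: le_trans (nrm_coord _ k); rewrite !mxE.
Qed.

(** Multiplication by the unit [u] makes the derivative real and nonnegative. The square of
    half-side [r / 4] fits into the disc, and subtracting the value at the centre doubles the bound,
    whence the constant 16. *)
Lemma cauchy_disc f a D r B : 0 < r ->
  (forall z, nrm (z - a) < r -> (exists E, hasd f z E) /\ nrm (f z) <= B) ->
  hasd f a D -> nrm D <= 16 * B / r.
Proof.
move=> r0 fB fD.
have B0 : 0 <= B.
  by have [|_ +] := fB a; [rewrite subrr nrm0|apply: le_trans; exact: nrm_ge0].
have [->|D0] := eqVneq D 0; first by rewrite nrm0 divr_ge0 ?mulr_ge0// ltW.
have nD0 : nrm D != 0 by apply: contra_neq D0; exact: nrm0_eq0.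
pose u : R[i] := (nrm D)%:C%C / D.
have nu : nrm u = 1 by rewrite nrmM nrmV nrm_real ger0_norm ?nrm_ge0// divff.
pose g z := u *: (f (z + a) - f a).
have gd z E : hasd f (z + a) E -> hasd g z (u *: E).
  by move=> fE; apply: hasdZ; rewrite -[E]subr0; exact: hasdB (hasd_shift fE) (hasd_cst _ _).
have r40 : 0 < r / 4 by rewrite divr_gt0.
have := @cauchy_square0 R g (nrm D) (r / 4) (2 * B) r40.
have -> : 2 * (2 * B) / (r / 4) = 16 * B / r by field; rewrite gt_eqF.
apply.
- by rewrite /g add0r subrr scaler0.
- have -> : (nrm D)%:C%C = u *: D by rewrite /u [_ *: _]divfK.
  by apply: gd; rewrite add0r.
- exact: nrm_ge0.
- move=> z zR zI; have zr : nrm (z + a - a) < r.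
    by rewrite addrK; apply: le_lt_trans (nrm_le_ReIm z) _; clear -zR zI r0; lra.
  have [[E fE] fzB] := fB _ zr.
  split; first by exists (u *: E); exact: gd.
  rewrite nrmZ nu mul1r; apply: le_trans (nrmB _ _) _.
  rewrite mulr_natl mulr2n lerD//.
  by have [|_ +] := fB a; rewrite ?subrr ?nrm0.
Qed.

Lemma cauchy_disc_rV n (w : R[i] -> 'rV[R[i]]_n) a D r B : 0 < r ->
  (forall z, nrm (z - a) < r -> (exists E, hasd w z E) /\ nrm (w z) <= B) ->
  hasd w a D -> nrm D <= 16 * B / r.
Proof.
move=> r0 wB wD.
have B0 : 0 <= B.
  by have [|_ +] := wB a; [rewrite subrr nrm0|apply: le_trans; exact: nrm_ge0].
apply: nrm_rV_le; first by rewrite divr_ge0 ?mulr_ge0// ltW.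
move=> k; apply: (@cauchy_disc (fun z => w z 0 k) a) => //; last exact: hasd_coord.
move=> z /wB[[E wE] wzB]; split; first by exists (E 0 k); exact: hasd_coord.
exact: le_trans (nrm_coord _ _) wzB.
Qed.

Lemma is_derive_eps (p : R -> R) t (l : R) :
  (forall e, 0 < e -> exists2 d, 0 < d & forall s, `|s| < d ->
     `|p (t + s) - p t - l * s| <= e * `|s|) -> is_derive t 1 p l.
Proof.
move=> pl.
have cv : h^-1 *: (p (h *: (1 : R) + t) - p t) @[h --> 0^'] --> l.
  apply/cvgrPdist_le => e e0; have [d d0 hd] := pl e e0.
  near=> h.
  have h0 : h != 0 by near: h; exact: nbhs_dnbhs_neq.
  have hd' : `|h| < d by near: h; apply: dnbhs0_lt.
  have := hd h hd'; rewrite -ler_pdivrMr ?normr_gt0// -normf_div; apply: le_trans.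
  rewrite distrC [h *: 1]mulr1 [h + t]addrC.
  suff -> : h^-1 *: (p (t + h) - p t) - l = (p (t + h) - p t - l * h) / h by [].
  by rewrite [_ *: _]mulrC; field.
by apply: DeriveDef; [apply/cvg_ex; exists l|apply/cvg_lim].
Unshelve. all: by end_near. Qed.

(** The real mean value theorem is applied separately to the real and the imaginary part of each
    coordinate, so the derivative need not be continuous; the price is the factor 2. *)
Lemma mean_value n (w : R[i] -> 'rV[R[i]]_n) a h L :
  (forall t, 0 <= t <= 1 -> exists2 D, hasd w (a + t%:C%C * h) D & nrm D <= L) ->
  nrm (w (a + h) - w a) <= 2 * L * nrm h.
Proof.
move=> wL.
have L0 : 0 <= L.
  by have [|D _] := wL 0; [rewrite lexx ler01|apply: le_trans; exact: nrm_ge0].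
apply: nrm_rV_le => [|k]; first by rewrite !mulr_ge0// nrm_ge0.
pose f z := w z 0 k.
have fL t : 0 <= t <= 1 -> exists2 D, hasd f (a + t%:C%C * h) D & nrm D <= L.
  move=> /wL[D wD DL]; exists (D 0 k); first exact: hasd_coord.
  exact: le_trans (nrm_coord _ _) DL.
have /choice[g gP] t : exists D, 0 <= t <= 1 -> hasd f (a + t%:C%C * h) D /\ nrm D <= L.
  have [/fL[D ? ?]|nt] := boolP (0 <= t <= 1); first by exists D.
  by exists 0.
have part (p : R[i] -> R) : (forall x y, p (x - y) = p x - p y) ->
    (forall s : R, forall x, p (x * s%:C%C) = p x * s) ->
    (forall x, `|p x| <= nrm x) -> `|p (f (a + h)) - p (f a)| <= L * nrm h.
  move=> pB pZ pn.
  have dp t : 0 <= t <= 1 -> is_derive t 1 (fun t => p (f (a + t%:C%C * h))) (p (g t * h)).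
    move=> tb; have [gt _] := gP t tb; apply: is_derive_eps => e e0.
    have h1 : 0 < nrm h + 1 by rewrite ltr_wpDl ?nrm_ge0.
    have [d d0 hd] := gt (e / (nrm h + 1)) (divr_gt0 e0 h1).
    exists (d / (nrm h + 1)); first by rewrite divr_gt0.
    move=> s; rewrite ltr_pdivlMr// => sd.
    have sh : nrm (s%:C%C * h) < d.
      rewrite nrmM nrm_real; apply: le_lt_trans sd.
      by rewrite ler_wpM2l// lerDl.
    have := hd _ sh; rewrite -pZ -!pB.
    have -> : a + (t + s)%:C%C * h = a + t%:C%C * h + s%:C%C * h.
      by rewrite rmorphD/= mulrDl addrA.
    have -> : (s%:C%C * h) *: g t = g t * h * s%:C%C.
      by rewrite [LHS]mulrC [s%:C%C * h]mulrC mulrA.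
    move=> hh; apply: le_trans (pn _) _; apply: le_trans hh _.
    rewrite nrmM nrm_real mulrCA mulrC ler_wpM2r// mulrAC -mulrA.
    by rewrite -[leRHS]mulr1 ler_wpM2l ?(ltW e0)// ler_pdivrMr// mul1r lerDl.
  pose q t := p (f (a + t%:C%C * h)).
  have dq (x : R) : x \in `]0, 1[ -> is_derive x 1 q (p (g x * h)).
    by rewrite in_itv/= => /andP[? ?]; apply: dp; rewrite !ltW.
  have cq : {within `[0 : R, 1], continuous q}.
    apply: derivable_within_continuous => x; rewrite in_itv/= => xb.
    by have [] := dp x xb.
  have [x] := MVT_segment ler01 dq cq; rewrite in_itv/= /q => x01 e.
  move: e; rewrite subr0 mulr1 mul1r mul0r addr0 => ->.
  apply: le_trans (pn _) _; rewrite nrmM ler_wpM2r ?nrm_ge0//.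
  by have [] := gP x x01.
have -> : (w (a + h) - w a) 0 k = f (a + h) - f a by rewrite !mxE.
apply: le_trans (nrm_le_ReIm _) _.
rewrite (_ : 2 * L * nrm h = L * nrm h + L * nrm h); last by ring.
apply: lerD.
  have -> : complex.Re (f (a + h) - f a) = complex.Re (f (a + h)) - complex.Re (f a) by exact: raddfB.
  by apply: part; [move=> [? ?] [? ?]|move=> s [x y] /=; ring|exact: Re_le_nrm].
have -> : complex.Im (f (a + h) - f a) = complex.Im (f (a + h)) - complex.Im (f a) by exact: raddfB.
by apply: part; [move=> [? ?] [? ?]|move=> s [x y] /=; ring|exact: Im_le_nrm].
Qed.

(** The derivative is Lipschitz by two uses of the Cauchy estimate; the mean value inequality for
    [w] minus its linear part then gives a quadratic error. Second derivatives never appear, and the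
    constant is independent of the function. *)
Lemma taylor : exists2 K : R, 0 < K &
  forall n (w : R[i] -> 'rV[R[i]]_n) a D r B, 0 < r ->
  (forall z, nrm (z - a) < r -> (exists E, hasd w z E) /\ nrm (w z) <= B) ->
  hasd w a D -> forall h, nrm h < r / 4 ->
  nrm (w (a + h) - w a - h *: D) <= K * B / r ^+ 2 * nrm h ^+ 2.
Proof.
exists 8192; first by rewrite ltr0n.
move=> n w a D r B r0 wB wD.
have B0 : 0 <= B.
  by have [|_ +] := wB a; [rewrite subrr nrm0|apply: le_trans; exact: nrm_ge0].
have r20 : 0 < r / 2 by rewrite divr_gt0.
have r40 : 0 < r / 4 by rewrite divr_gt0.
have c1 z E : nrm (z - a) < r / 2 -> hasd w z E -> nrm E <= 32 * B / r.
  move=> za wE; have -> : 32 * B / r = 16 * B / (r / 2) by field; rewrite gt_eqF.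
  apply: cauchy_disc_rV r20 _ wE => y yz; apply: wB.
  apply: le_lt_trans (nrm_trans _ z _) _; clear -yz za; lra.
(* The Cauchy estimate is applied to the increment [w (z + h) - w z], which is O(|h|) by [c1] and
   the mean value inequality. *)
have c2 h E : nrm h < r / 4 -> hasd w (a + h) E -> nrm (E - D) <= 4096 * B / r ^+ 2 * nrm h.
  move=> hr wE.
  have -> : 4096 * B / r ^+ 2 * nrm h = 16 * (2 * (32 * B / r) * nrm h) / (r / 4).
    by field; rewrite gt_eqF.
  apply: (@cauchy_disc_rV _ (fun z => w (z + h) - w z) a _ _ _ r40); last first.
    exact: (hasdB (hasd_shift wE) wD).
  move=> z zr.
  have zh : nrm (z + h - a) < r.
    rewrite addrAC; apply: le_lt_trans (nrmD _ _) _; clear -zr hr r0; lra.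
  have [[E1 wE1] _] := wB _ zh.
  have zr' : nrm (z - a) < r by clear -zr r0; lra.
  have [[E2 wE2] _] := wB _ zr'.
  split; first by exists (E1 - E2); exact: (hasdB (hasd_shift wE1) wE2).
  apply: mean_value => t /andP[t0 t1].
  have zt : nrm (z + t%:C%C * h - a) < r / 2.
    rewrite addrAC; apply: le_lt_trans (nrmD _ _) _; rewrite nrmM nrm_real ger0_norm//.
    have : t * nrm h <= nrm h by rewrite ler_piMl ?nrm_ge0.
    by clear -zr hr r0; lra.
  have [|[E3 wE3] _] := wB (z + t%:C%C * h); first by clear -zt r0; lra.
  by exists E3 => //; exact: c1 wE3.
move=> h hr.
have := @mean_value _ (fun z => w z - (z - a) *: D) a h (4096 * B / r ^+ 2 * nrm h) _.
rewrite subrr scale0r subr0 (_ : a + h - a = h); last by rewrite addrAC subrr add0r.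
rewrite [w (a + h) - _ - w a]addrAC.
rewrite (_ : 2 * _ * nrm h = 8192 * B / r ^+ 2 * nrm h ^+ 2); last by field; rewrite gt_eqF.
apply => t /andP[t0 t1].
have th : nrm (t%:C%C * h) <= nrm h by rewrite nrmM nrm_real ger0_norm// ler_piMl ?nrm_ge0.
have [|[E wE] _] := wB (a + t%:C%C * h).
  by rewrite [a + _ - a]addrAC subrr add0r; clear -th hr r0; lra.
exists (E - D); first exact: hasdB wE (hasd_lin _ _ _).
apply: le_trans (c2 _ _ _ wE) _; first exact: le_lt_trans hr.
apply: ler_wpM2l th; apply: divr_ge0; last by rewrite exprn_ge0// ltW.
by apply: mulr_ge0 B0; exact: ler0n.
Qed.

End taylor.

(** * Weierstrass' theorem for vector-valued functions *)

Section weierstrass.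
Variable R : realType.

Lemma real_cauchy_cvg (x : nat -> R) :
  (forall e : R, 0 < e -> exists J, forall j, (J <= j)%N -> `|x j - x J| < e) ->
  exists l : R, x @ \oo --> l.
Proof.
move=> cx; have /cvg_ex[l xl] : cvg (x @ \oo).
  apply: cauchy_cvg; apply: cauchy_exP => e e0; have [J hJ] := cx e e0.
  by exists (x J); exists J => // j /hJ; rewrite -ball_normE /= distrC.
by exists l.
Qed.

Lemma rV_cauchy_cvg n (D : nat -> 'rV[R[i]]_n) :
  (forall e : R, 0 < e -> exists J, forall j, (J <= j)%N -> nrm (D j - D J) < e) ->
  exists l, forall e : R, 0 < e -> \forall j \near \oo, nrm (D j - l) < e.
Proof.
move=> cD.
have cRe k : exists l : R, (fun j => complex.Re (D j 0 k)) @ \oo --> l.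
  apply: real_cauchy_cvg => e /cD[J hJ]; exists J => j /hJ; apply: le_lt_trans.
  have := nrm_coord (D j - D J) k; rewrite !mxE; apply: le_trans.
  by rewrite -raddfB; exact: Re_le_nrm.
have cIm k : exists l : R, (fun j => complex.Im (D j 0 k)) @ \oo --> l.
  apply: real_cauchy_cvg => e /cD[J hJ]; exists J => j /hJ; apply: le_lt_trans.
  have := nrm_coord (D j - D J) k; rewrite !mxE; apply: le_trans.
  by rewrite -raddfB; exact: Im_le_nrm.
have /choice[a aP] := cRe; have /choice[b bP] := cIm.
exists (\row_k (Complex (a k) (b k))) => e e0.
have e40 : 0 < e / 4 by rewrite divr_gt0.
have : \forall j \near \oo, forall k, `|a k - complex.Re (D j 0 k)| < e / 4 /\
    `|b k - complex.Im (D j 0 k)| < e / 4.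
  apply: filter_forall => k; near=> j; split; near: j.
    by have /cvgrPdist_lt/(_ _ e40) := aP k.
  by have /cvgrPdist_lt/(_ _ e40) := bP k.
apply: filterS => j h; apply: (@le_lt_trans _ _ (e / 2)); last by clear -e0; lra.
apply: nrm_rV_le => [|k]; first by rewrite divr_ge0// ltW.
have [h1 h2] := h k; rewrite !mxE nrmBC; apply: le_trans (nrm_le_ReIm _) _.
rewrite !raddfB /=; move: h1 h2; clear; lra.
Unshelve. all: by end_near. Qed.

(** Pointwise convergence is enough because the common bound gives one Taylor constant [K] for all
    late [j]: difference quotients at a fixed small step force the derivatives to be Cauchy, and the
    Taylor bound survives the limit. *)
Lemma weierstrass n (w : nat -> R[i] -> 'rV[R[i]]_n) (Dw : nat -> 'rV[R[i]]_n)
    (v : R[i] -> 'rV[R[i]]_n) (a : R[i]) (r B : R) : 0 < r ->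
  (\forall j \near \oo, hasd (w j) a (Dw j) /\ forall z, nrm (z - a) < r ->
     (exists E, hasd (w j) z E) /\ nrm (w j z) <= B) ->
  (forall z, nrm (z - a) < r -> forall e : R, 0 < e ->
     \forall j \near \oo, nrm (w j z - v z) < e) ->
  exists2 D, hasd v a D & forall e : R, 0 < e -> \forall j \near \oo, nrm (Dw j - D) < e.
Proof.
move=> r0 wB wv.
have [C C0 taylorC] := taylor R.
pose K := C * `|B| / r ^+ 2 + 1.
have K0 : 0 < K.
  apply: ltr_wpDl => //; apply: divr_ge0; last by rewrite exprn_ge0// ltW.
  by rewrite mulr_ge0// ltW.
have T : \forall j \near \oo, forall h, nrm h < r / 4 ->
    nrm (w j (a + h) - w j a - h *: Dw j) <= K * nrm h ^+ 2.
  apply: filterS wB => j [wD wB] h hr.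
  apply: (le_trans (taylorC _ _ _ _ _ _ r0 wB wD _ hr)).
  apply: ler_wpM2r; first by rewrite exprn_ge0// nrm_ge0.
  apply: ler_wpDr => //; apply: ler_wpM2r; first by rewrite invr_ge0 exprn_ge0// ltW.
  by apply: ler_wpM2l; [exact: ltW|exact: ler_norm].
have wv' h (e : R) : nrm h < r / 4 -> 0 < e -> \forall j \near \oo,
    nrm (w j (a + h) - w j a - (v (a + h) - v a)) < e.
  move=> hr e0; have e20 : 0 < e / 2 by rewrite divr_gt0.
  have h1 : \forall j \near \oo, nrm (w j (a + h) - v (a + h)) < e / 2.
    by apply: wv => //; rewrite addrAC subrr add0r; clear -r0 hr; lra.
  have h2 : \forall j \near \oo, nrm (w j a - v a) < e / 2.
    by apply: wv => //; rewrite subrr nrm0.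
  apply: filterS2 h1 h2 => j h1 h2.
  have -> : w j (a + h) - w j a - (v (a + h) - v a) = w j (a + h) - v (a + h) - (w j a - v a).
    by rewrite opprB addrACA [RHS]addrAC opprB -!addrA; congr (_ + _); rewrite addrCA.
  by apply: le_lt_trans (nrmB _ _) _; rewrite (splitr e) ltrD.
have [D DP] : exists D, forall e : R, 0 < e -> \forall j \near \oo, nrm (Dw j - D) < e.
  apply: rV_cauchy_cvg => e e0.
  (* The step lies in the range of the Taylor bound, and its quadratic error, divided by [t], is at
     most [e / 8]. *)
  pose t := Num.min (r / 8) (e / (8 * K)).
  have t0 : 0 < t by rewrite lt_min !divr_gt0// mulr_gt0.
  have tr : nrm (t%:C%C : R[i]) < r / 4.
    rewrite nrm_real gtr0_norm// /t gt_min; apply/orP; left; clear -r0; lra.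
  have tK : K * t <= e / 8.
    have : t <= e / (8 * K) by rewrite /t ge_min lexx orbT.
    by rewrite ler_pdivlMr ?mulr_gt0//; clear; lra.
  have et0 : 0 < e * t / 8 by rewrite divr_gt0// mulr_gt0.
  have N : \forall j \near \oo, nrm (t%:C%C *: Dw j - (v (a + t%:C%C) - v a)) <= e * t / 4.
    apply: filterS2 T (wv' _ _ tr et0) => j /(_ _ tr) h1 h2.
    apply: le_trans (nrm_trans _ (w j (a + t%:C%C) - w j a) _) _.
    rewrite nrmBC; move: h1; rewrite nrm_real (gtr0_norm t0).
    have : K * t ^+ 2 <= e * t / 8 by rewrite expr2 mulrA [e * t / 8]mulrAC ler_wpM2r// ltW.
    by move: h2; clear; lra.
  have [J _ hJ] := N; exists J => j Jj.
  have : nrm (t%:C%C *: (Dw j - Dw J)) <= e * t / 2.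
    rewrite scalerBr; apply: le_trans (nrm_trans _ (v (a + t%:C%C) - v a) _) _.
    have := hJ j Jj; have := hJ J (leqnn _); rewrite [nrm (_ - t%:C%C *: _)]nrmBC.
    by move: (nrm _) (nrm _) (e * t) => p q s; clear; lra.
  rewrite nrmZ nrm_real gtr0_norm// mulrC [e * t]mulrC -mulrA [leRHS]mulrC ler_pM2r//.
  by clear -e0; lra.
exists D => // e e0.
exists (Num.min (r / 4) (e / K)); first by rewrite lt_min !divr_gt0.
move=> h; rewrite lt_min => /andP[hr]; rewrite ltr_pdivlMr// => hK.
apply: (@le_trans _ _ (K * nrm h ^+ 2)); last first.
  by rewrite expr2 mulrA ler_wpM2r ?nrm_ge0// mulrC ltW.
(* The Taylor bound passes to [v] up to an error [d], through a single index [j] at which all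
   approximations hold. *)
apply/ler_addgt0Pr => d d0.
have d20 : 0 < d / 2 by rewrite divr_gt0.
have dh0 : 0 < d / 2 / (nrm h + 1) by rewrite divr_gt0// ltr_wpDl ?nrm_ge0.
have [j [[h1 h2] h3]] := filter_ex (filterI (filterI T (wv' h _ hr d20)) (DP _ dh0)).
have -> : v (a + h) - v a - h *: D = (w j (a + h) - w j a - h *: Dw j)
   - (w j (a + h) - w j a - (v (a + h) - v a)) + h *: (Dw j - D).
  rewrite scalerBr; move: (w j (a + h) - w j a) (v _ - v _) (h *: D) (h *: Dw j) => p q x y.
  have -> : p - y - (p - q) = q - y by rewrite opprB addrC addrA subrK.
  by rewrite addrA subrK.
apply: le_trans (nrmD _ _) _; have := nrmB (w j (a + h) - w j a - h *: Dw j)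
   (w j (a + h) - w j a - (v (a + h) - v a)).
have h4 : nrm (h *: (Dw j - D)) <= d / 2.
  rewrite nrmZ; move: h3; rewrite ltr_pdivlMr ?ltr_wpDl ?nrm_ge0// mulrC => /ltW.
  by apply: le_trans; rewrite ler_wpM2r ?nrm_ge0// lerDl.
have := h1 h hr; move: h2 h4; clear; lra.
Qed.

End weierstrass.

(** * Hermitian metrics in charts *)

Section hform.
Variables (R : realType) (n : nat).
Implicit Types (A B : 'M[R[i]]_n) (v w : 'rV[R[i]]_n).

Lemma hformDl A v v' w : hform A (v + v') w = hform A v w + hform A v' w.
Proof.
rewrite /hform -big_split; apply: eq_bigr => i _; rewrite -big_split; apply: eq_bigr => j _.
by rewrite !mxE mulrDr mulrDl.
Qed.

Lemma hformZl A a v w : hform A (a *: v) w = a * hform A v w.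
Proof.
rewrite /hform mulr_sumr; apply: eq_bigr => i _; rewrite mulr_sumr; apply: eq_bigr => j _.
by rewrite !mxE mulrCA -!mulrA.
Qed.

Lemma hformDr A v w w' : hform A v (w + w') = hform A v w + hform A v w'.
Proof.
rewrite /hform -big_split; apply: eq_bigr => i _; rewrite -big_split; apply: eq_bigr => j _.
by rewrite !mxE rmorphD mulrDr.
Qed.

Lemma hformZr A a v w : hform A v (a *: w) = a^* * hform A v w.
Proof.
rewrite /hform mulr_sumr; apply: eq_bigr => i _; rewrite mulr_sumr; apply: eq_bigr => j _.
by rewrite !mxE rmorphM mulrCA.
Qed.

Lemma hformBm A B v w : hform (A - B) v w = hform A v w - hform B v w.
Proof.
rewrite /hform -sumrB; apply: eq_bigr => i _; rewrite -sumrB; apply: eq_bigr => j _.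
by rewrite !mxE !mulrBl.
Qed.

Lemma hform_conj A v w : (forall i j, A j i = (A i j)^*) -> hform A w v = (hform A v w)^*.
Proof.
move=> Ah; rewrite /hform rmorph_sum exchange_big; apply: eq_bigr => i _.
rewrite rmorph_sum; apply: eq_bigr => j _.
by rewrite !rmorphM /= conjCK -Ah mulrAC.
Qed.

Lemma nrm_conj (z : R[i]) : nrm (z^*) = nrm z.
Proof. by rewrite /nrm norm_conjC. Qed.

Lemma nrm_sum (I : Type) (s : seq I) (P : pred I) (F : I -> R[i]) :
  nrm (\sum_(i <- s | P i) F i) <= \sum_(i <- s | P i) nrm (F i).
Proof.
elim/big_rec2: _ => [|i x y _ le]; first by rewrite nrm0.
by apply: le_trans (nrmD _ _) _; rewrite lerD2l.
Qed.

Lemma hform_le A v : nrm (hform A v v) <= (\sum_i \sum_j nrm (A i j)) * nrm v ^+ 2.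
Proof.
apply: le_trans (nrm_sum _ _ _) _; rewrite mulr_suml; apply: ler_sum => i _.
apply: le_trans (nrm_sum _ _ _) _; rewrite mulr_suml; apply: ler_sum => j _.
rewrite !nrmM nrm_conj expr2 -mulrA ler_wpM2l ?nrm_ge0// ler_pM ?nrm_ge0 ?nrm_coord//.
Qed.

(* A is invertible, so each coordinate of v is the product of v with a fixed vector,
   and the Cauchy-Schwarz inequality for the form A bounds it. *)
Lemma hform_ge A : (forall i j, A j i = (A i j)^*) -> (forall v, v != 0 -> 0 < hform A v v) ->
  exists2 l : R, 0 < l & forall v, l * nrm v ^+ 2 <= complex.Re (hform A v v).
Proof.
move=> Ah Ap.
have hE v w : hform A v w = \sum_j (v *m A) 0 j * (w 0 j)^*.
  rewrite /hform exchange_big; apply: eq_bigr => j _; rewrite mxE mulr_suml.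
  by apply: eq_bigr => i _; rewrite [A i j * _]mulrC.
have A1 : A \in unitmx.
  rewrite -row_free_unit -kermx_eq0; apply/rowV0P => v /sub_kermxP vA.
  apply/eqP/negPn/negP => /Ap; rewrite hE vA big1 ?ltxx// => j _.
  by rewrite mxE mul0r.
have Ap0 v : 0 <= hform A v v.
  have [->|/Ap/ltW//] := eqVneq v 0.
  by rewrite -(scale0r (0 : 'rV_n)) hformZl mul0r.
have Re_ge0 (z : R[i]) : 0 <= z -> 0 <= complex.Re z by rewrite lecE => /andP[].
have key k : exists2 C : R, 0 <= C & forall v, nrm (v 0 k) ^+ 2 <= C * complex.Re (hform A v v).
  (* The conjugated column [k] of the inverse of [A] represents the [k]-th coordinate with respect
     to the form. *)
  pose w : 'rV[R[i]]_n := \row_j ((invmx A) j k)^*.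
  have vw v : hform A v w = v 0 k.
    rewrite hE -[in RHS](mulmxK A1 v) mxE; apply: eq_bigr => j _.
    by rewrite [w 0 j]mxE conjCK.
  have W0 := Ap0 w.
  exists (complex.Re (hform A w w)).
    by move: W0; rewrite lecE => /andP[].
  move=> v; have H0 := Ap0 v.
  have [wn|wn] := eqVneq w 0.
    have -> : v 0 k = 0 by rewrite -vw wn -(scale0r (0 : 'rV_n)) hformZr conjC0 mul0r.
    by rewrite nrm0 expr0n /= mulr_ge0// Re_ge0.
  have Wp := Ap _ wn.
  set W := hform A w w in W0 Wp *; set H := hform A v v in H0 *.
  have Wr : W^* = W by rewrite (CrealP _)// ger0_real.
  (* This vector is [W] times the component of [v] orthogonal to [w]. *)
  have := Ap0 (W *: v + (- v 0 k) *: w).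
  rewrite hformDl !hformDr !hformZl !hformZr -/W -/H vw (hform_conj v w Ah) vw Wr rmorphN.
  have -> : W * (W * H) + W * (- (v 0 k)^* * v 0 k) + (- v 0 k * (W * (v 0 k)^*) + - v 0 k * (- (v 0 k)^* * W)) =
    W * (W * H - v 0 k * (v 0 k)^*) by ring.
  rewrite pmulr_rge0// subr_ge0 -normCK nrmE -rmorphXn /=.
  have {1}-> : W = (complex.Re W)%:C%C by rewrite RRe_real// ger0_real.
  have {1}-> : H = (complex.Re H)%:C%C by rewrite RRe_real// ger0_real.
  by rewrite -rmorphM lecR.
have /choice[C CP] : forall k, exists C : R, 0 <= C /\ forall v, nrm (v 0 k) ^+ 2 <= C * complex.Re (hform A v v).
  by move=> k; have [C ? ?] := key k; exists C.
pose S := 1 + \sum_k C k.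
have S1 : 1 <= S by rewrite lerDl sumr_ge0// => k _; case: (CP k).
have S0 : 0 < S by apply: lt_le_trans S1.
exists S^-1; first by rewrite invr_gt0.
move=> v; rewrite mulrC ler_pdivrMr//.
have H0 : 0 <= complex.Re (hform A v v) by have := Ap0 v; rewrite lecE => /andP[].
have SH0 : 0 <= complex.Re (hform A v v) * S by rewrite mulr_ge0// ltW.
rewrite -(sqr_sqrtr SH0) ler_pXn2r// ?nnegrE ?nrm_ge0 ?sqrtr_ge0//.
apply: nrm_rV_le; first exact: sqrtr_ge0.
move=> k; rewrite -(ler_pXn2r (_ : 0 < 2)%N)// ?nnegrE ?nrm_ge0 ?sqrtr_ge0// sqr_sqrtr//.
have [Ck0 Ck] := CP k; apply: le_trans (Ck v) _; rewrite mulrC ler_wpM2l//.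
rewrite /S (bigD1 k)//= addrCA lerDl addr_ge0// sumr_ge0// => i _.
by case: (CP i).
Qed.

End hform.

Section metric.
Variables (R : realType) (n : nat) (M : topologicalType).
Variables (X : complex_manifold R n M) (h : hermitian_metric X).

Lemma hmx_cvg c p (e : R) : atlas X c -> cdom c p -> 0 < e ->
  \forall q \near p, forall i j, nrm (hmx h c q i j - hmx h c p i j) < e.
Proof.
move=> ac cp e0.
apply: filter_forall => i; apply: filter_forall => j.
have [gc _] := hmx_smooth h ac i j 0%N.
have {}gc := gc _ (cmap_cod cp).
have cc := cvg_comp _ _ (cmap_continuous cp) gc.
rewrite (cmapK cp) in cc.
have /cvg_nrmP/(_ e e0) := cc.
have : \forall q \near p, cdom c q.
  exact: open_nbhs_nbhs (conj (cdom_open c) cp).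
by apply: filterS2 => q cq /=; rewrite cmapK.
Qed.

(** Near [p] each matrix entry moves by less than [e], so the form moves by at most [n * n * e]
    times the squared norm, which [e] keeps below half the lower bound at [p]. *)
Lemma metric_bounds c p : atlas X c -> cdom c p -> exists l L : R,
  [/\ 0 < l, 0 < L & \forall q \near p, forall v,
    l * nrm v ^+ 2 <= complex.Re (hform (hmx h c q) v v) <= L * nrm v ^+ 2].
Proof.
move=> ac cp.
have [l l0 lP] := hform_ge (hmx_hermitian h ac cp) (hmx_posdef h ac cp).
pose A := hmx h c p.
pose S := \sum_i \sum_j nrm (A i j).
have S0 : 0 <= S by do 2!apply: sumr_ge0 => ? _; exact: nrm_ge0.
(* The added 1 keeps the divisor positive in dimension 0. *)
pose N : R := (n * n)%:R + 1.
have N0 : 0 < N by rewrite ltr_wpDl.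
pose e := l / (2 * N).
have e0 : 0 < e by rewrite divr_gt0// mulr_gt0.
exists (l / 2), (S + l); split; [by rewrite divr_gt0|by rewrite ltr_wpDl|].
apply: filterS (hmx_cvg ac cp e0) => q qe v.
have D : `|complex.Re (hform (hmx h c q) v v) - complex.Re (hform A v v)| <= l / 2 * nrm v ^+ 2.
  rewrite -raddfB; apply: le_trans (Re_le_nrm _) _; rewrite -hformBm.
  apply: le_trans (hform_le _ _) _; apply: ler_wpM2r; first by rewrite exprn_ge0// nrm_ge0.
  apply: (@le_trans _ _ (\sum_(i < n) \sum_(j < n) e)).
    by do 2!apply: ler_sum => ? _; rewrite !mxE ltW.
  rewrite !sumr_const card_ord -mulrnA -[e *+ _]mulr_natr.
  apply: (@le_trans _ _ (e * N)); first by rewrite ler_wpM2l ?(ltW e0)// lerDl.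
  by rewrite /e le_eqVlt; apply/orP; left; apply/eqP; field; rewrite gt_eqF.
have U : complex.Re (hform A v v) <= S * nrm v ^+ 2.
  by apply: le_trans (hform_le _ _); apply: le_trans (Re_le_nrm _); exact: ler_norm.
have Lo := lP v; move: D U Lo; rewrite -/A !ler_norml.
move: (complex.Re _) (complex.Re _) => x y.
have v0 : 0 <= nrm v ^+ 2 by rewrite exprn_ge0// nrm_ge0.
have l2 : 0 <= l / 2 * nrm v ^+ 2 by rewrite mulr_ge0// divr_ge0// ltW.
have -> : l / 2 * nrm v ^+ 2 = l * nrm v ^+ 2 / 2 by ring.
rewrite mulrDl; rewrite mulrAC in l2; move: l2.
move: (l * _) (S * _) => s t; clear => ? /andP[? ?] ? ?; apply/andP; split; lra.
Qed.

End metric.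

(** * Holomorphic curves and their speed *)

Section curves.
Variables (R : realType) (n : nat) (M : uniformType).
Variables (X : complex_manifold R n M) (h : hermitian_metric X).

Definition len (V : normedModType R[i]) (f : holomap V X) z v : R :=
  tangent_length h (differential f z v).

Lemma len_chart (V : normedModType R[i]) (f : holomap V X) z v c :
  atlas X c -> cdom c (f z) ->
  len f z v = Num.sqrt (complex.Re (hform (hmx h c (f z)) ('d (c \o f) z v) ('d (c \o f) z v))).
Proof.
by move=> ac cc; rewrite /len (tangent_lengthE h _ (exist _ c (conj ac cc))).
Qed.

Lemma len_ge0 (V : normedModType R[i]) (f : holomap V X) z v : 0 <= len f z v.
Proof. exact: sqrtr_ge0. Qed.

Lemma lenZ (V : normedModType R[i]) (f : holomap V X) z v (t : R) :
  len f z (t%:C%C *: v) = `|t| * len f z v.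
Proof.
have [c [ac cc]] := atlas_cover X (f z).
rewrite !(len_chart _ ac cc) linearZ /= hformZl hformZr mulrA.
have -> : (t%:C%C : R[i]) * (t%:C%C)^* = (t ^+ 2)%:C%C.
  by rewrite (CrealP _) ?complex_real// -rmorphM expr2.
case: (hform _ _ _) => a b /=; rewrite mul0r subr0.
by rewrite sqrtrM ?sqr_ge0// sqrtr_sqr.
Qed.

Lemma hasd_affine (V : normedModType R[i]) (a b : V) (z : R[i]) :
  hasd (fun z => a + z *: b) z b.
Proof.
move=> e e0; exists 1 => // k _.
rewrite scalerDl addrA (addrAC (a + z *: b)) subrr add0r subrr nrm0.
by apply: mulr_ge0; [exact: ltW|exact: nrm_ge0].
Qed.

Section curve.
Variables (V : normedModType R[i]) (f : holomap V X) (a b : V).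

Lemma curve_continuous : continuous (fun z : R[i] => f (a + z *: b)).
Proof.
move=> z; apply: (@continuous_comp _ _ _ (fun z : R[i] => a + z *: b) f).
  by apply: differentiable_continuous; have /hasdP[] := hasd_affine a b z.
exact: hfun_continuous.
Qed.

Lemma curve_holomorphic z c : atlas X c -> cdom c (f (a + z *: b)) ->
  differentiable (c \o (fun z : R[i] => f (a + z *: b))) z.
Proof.
move=> ac cc.
apply: (@differentiable_comp _ _ _ _ (fun z : R[i] => a + z *: b) (c \o f)).
  by have /hasdP[] := hasd_affine a b z.
exact: hfun_holomorphic.
Qed.

Definition curve : holomap R[i] X := Holomap curve_continuous curve_holomorphic.

End curve.

Definition speed (u : holomap R[i] X) (z : R[i]) : R := len u z 1.

Lemma speed_curve (V : normedModType R[i]) (f : holomap V X) (a b : V) z :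
  speed (curve f a b) z = len f (a + z *: b) b.
Proof.
have [c [ac cc]] := atlas_cover X (f (a + z *: b)).
rewrite /speed (@len_chart _ (curve f a b) z 1 c ac cc) (len_chart _ ac cc).
have /hasdP[di dE] := hasd_affine a b z.
have df := hfun_holomorphic ac cc.
have e := diff_comp di df.
have {}e : 'd (c \o curve f a b) z 1 = 'd (c \o f) (a + z *: b) b.
  by have := congr1 (@^~ 1) e; rewrite /= dE.
by rewrite e.
Qed.

Lemma chart_hasd (u : holomap R[i] X) z c : atlas X c -> cdom c (u z) ->
  exists D, hasd (c \o u) z D.
Proof.
by move=> ac cc; exists ('d (c \o u) z 1); apply/hasdP; split=> //; exact: hfun_holomorphic.
Qed.

Lemma speed_chart (u : holomap R[i] X) z c D : atlas X c -> cdom c (u z) ->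
  hasd (c \o u) z D -> speed u z = Num.sqrt (complex.Re (hform (hmx h c (u z)) D D)).
Proof. by move=> ac cc /hasdP[_ <-]; exact: len_chart. Qed.

(* Since N is closed and contains the coordinate ball of radius s, a curve that
   starts close to p can leave N only by travelling a definite distance. *)
Record box (p : M) (c : chart R n M) (N : set M) (s l L B : R) : Prop := Box {
  box_atlas : atlas X c;
  box_dom : cdom c p;
  box_closed : closed N;
  box_nbhs : nbhs p N;
  box_sub : N `<=` cdom c;
  box_s : 0 < s;
  box_l : 0 < l;
  box_L : 0 < L;
  box_metric : forall q, N q -> forall v,
    l * nrm v <= Num.sqrt (complex.Re (hform (hmx h c q) v v)) <= L * nrm v;
  box_ball : forall q, cdom c q -> nrm (c q - c p) < s -> N q;
  box_bounded : forall q, N q -> nrm (c q) <= B }.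

Lemma cmap_near (c : chart R n M) p (e : R) : cdom c p -> 0 < e ->
  \forall q \near p, cdom c q /\ nrm (c q - c p) < e.
Proof.
move=> cp e0; have := cmap_continuous cp; move=> /cvg_nrmP/(_ e e0).
have : \forall q \near p, cdom c q by exact: open_nbhs_nbhs (conj (cdom_open c) cp).
by apply: filterS2.
Qed.

(** Uniform spaces are regular, so the neighbourhood on which the bounds hold contains the closure
    of a smaller one. Closedness in M, not just in coordinates, is what lets limits of curves stay
    in it. *)
Lemma box_exists p c (U : set M) : atlas X c -> cdom c p -> nbhs p U ->
  exists N s l L B, box p c N s l L B /\ N `<=` U.
Proof.
move=> ac cp Up.
have [l [L [l0 L0 lL]]] := metric_bounds h ac cp.
have cn := cmap_near cp ltr01.
have [V Vp VU] := @uniform_regular M p _ (filterI Up (filterI lL cn)).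
have NU q : closure V q -> U q by move=> /VU[].
have [s s0 sP] : exists2 s : R, 0 < s & forall y, nrm (y - c p) < s -> closure V (cinv c y).
  have := cinv_continuous (cmap_cod cp); rewrite (cmapK cp).
  have clV : nbhs p (closure V) by apply: filterS Vp; exact: subset_closure.
  by move=> /(_ _ clV) /nbhs_nrmP.
exists (closure V), s, (Num.sqrt l), (Num.sqrt L), (nrm (c p) + 1); split; last exact: NU.
split=> //.
- exact: closed_closure.
- by apply: filterS Vp; exact: subset_closure.
- by move=> q /VU[_ [_ []]].
- by rewrite sqrtr_gt0.
- by rewrite sqrtr_gt0.
- move=> q /VU[_ [+ _]] v; move=> /(_ v)/andP[lv Lv].
  have nE : nrm v = Num.sqrt (nrm v ^+ 2) by rewrite sqrtr_sqr ger0_norm// nrm_ge0.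
  by rewrite nE -!sqrtrM ?(ltW l0) ?(ltW L0)// !ler_wsqrtr.
- by move=> q cq qs; rewrite -(cmapK cq); exact: sP.
- move=> q /VU[_ [_ [_ /ltW qp]]].
  by have := nrmD (c q - c p) (c p); rewrite subrK => /le_trans; apply; rewrite addrC lerD2l.
Qed.

(** The supremum of the times in [0, 1] satisfying [E] satisfies [E] by the last clause and cannot
    be exceeded, so the third clause pushes past 1. *)
Lemma real_induction (E : R -> Prop) : E 0 ->
  (forall s t, 0 <= s <= t -> E t -> E s) ->
  (forall t, 0 <= t <= 1 -> E t -> exists2 d, 0 < d & E (t + d)) ->
  (forall t, 0 < t <= 1 -> (forall s, 0 <= s < t -> E s) -> E t) -> E 1.
Proof.
move=> E0 Edn Eup Ecl.
pose A : set R := [set t | 0 <= t <= 1 /\ E t].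
have hs : has_sup A.
  by split; [exists 0; split; rewrite ?lexx ?ler01|exists 1 => t [/andP[]]].
have s0 : 0 <= sup A by apply: (ub_le_sup hs.2); split; rewrite ?lexx ?ler01.
have s1 : sup A <= 1 by apply: (ge_sup hs.1) => t [/andP[]].
have Es : E (sup A).
  have [->//|sn0] := eqVneq (sup A) 0.
  apply: Ecl => [|s /andP[s0' ss]]; first by rewrite lt_neqAle eq_sym sn0 s0.
  have [|t [tb Et] st] := @sup_adherent _ A (sup A - s) _ hs; first by rewrite subr_gt0.
  by apply: Edn Et; rewrite s0' ltW//; move: st; rewrite opprB addrC subrK.
have sb : 0 <= sup A <= 1 by rewrite s0.
have [d d0 Ed] := Eup _ sb Es.
have [//|sd] := leP 1 (sup A + d); first by move=> h1; apply: Edn Ed; rewrite ler01.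
exfalso; have : sup A + d <= sup A.
  by apply: (ub_le_sup hs.2); split=> //; rewrite (ltW sd) andbT addr_ge0// ltW.
by rewrite gerDl leNgt d0.
Qed.

(** While the path is in [N], its coordinate speed is at most [k / l], so it moves by at most
    [s / 2] and is strictly inside the coordinate ball of radius [s]: it can be continued in [N].
    Closedness of [N] covers limit times. *)
Lemma stay p c N s l L B (u : holomap R[i] X) (z0 : R[i]) (k d : R) :
  box p c N s l L B -> cdom c (u z0) -> nrm (c (u z0) - c p) < s / 2 ->
  0 <= k -> (forall z, nrm (z - z0) < d -> speed u z <= k) ->
  2 * (k / l) * d <= s / 2 ->
  forall z, nrm (z - z0) < d -> N (u z) /\
     nrm (c (u z) - c (u z0)) <= 2 * (k / l) * nrm (z - z0).
Proof.
move=> bx c0 cs k0 uk kd z zd.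
have l0 := box_l bx.
pose y := z - z0; pose g (t : R) := u (z0 + t%:C%C * y).
have kl0 : 0 <= k / l by rewrite divr_ge0// ltW.
(* The whole past is recorded, since the mean value inequality needs the chart along the entire
   segment. *)
pose E t := forall s, 0 <= s <= t -> N (g s).
have ty t : 0 <= t <= 1 -> nrm (t%:C%C * y) <= nrm y.
  by move=> /andP[t0 t1]; rewrite nrmM nrm_real ger0_norm// ler_piMl ?nrm_ge0.
have mv t : 0 <= t <= 1 -> E t ->
    nrm (c (g t) - c (u z0)) <= 2 * (k / l) * nrm (t%:C%C * y).
  move=> tb Et; apply: (@mean_value _ _ (c \o u) z0) => r /andP[r0 r1].
  have rt : 0 <= r * t <= t by case/andP: tb => t0 _; rewrite mulr_ge0//= ler_piMl.
  have Nr := Et _ rt; rewrite /g rmorphM /= -mulrA in Nr.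
  have [D uD] := chart_hasd (box_atlas bx) (box_sub bx Nr).
  exists D => //; rewrite ler_pdivlMr// mulrC.
  have /andP[+ _] := box_metric bx Nr D; move=> /le_trans; apply.
  rewrite -(speed_chart (box_atlas bx) (box_sub bx Nr) uD); apply: uk.
  rewrite addrAC subrr add0r mulrA -rmorphM; apply: le_lt_trans (ty _ _) zd.
  case/andP: tb rt => _ t1 /andP[-> rt]; exact: le_trans rt t1.
have gc t : {for t, continuous g}.
  apply: (@continuous_comp _ _ _ (fun t : R => z0 + t%:C%C * y) u); last exact: hfun_continuous.
  apply/cvg_nrmP => e e0; have y1 : 0 < nrm y + 1 by rewrite ltr_wpDl ?nrm_ge0.
  have : \forall r \near t, `|t - r| < e / (nrm y + 1).
    by apply/nbhs_ballP; exists (e / (nrm y + 1)); rewrite /= ?divr_gt0// => r; rewrite -ball_normE.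
  apply: filterS => r; rewrite ltr_pdivlMr// => re.
  rewrite opprD addrACA subrr add0r -mulrBl -rmorphB nrmM nrm_real distrC.
  by apply: le_lt_trans re; rewrite ler_wpM2l// lerDl.
have g0 : g 0 = u z0 by rewrite /g mul0r addr0.
have E1 : E 1.
  apply: real_induction.
  - move=> t /andP[t0 t0']; have -> : t = 0 by apply/eqP; rewrite eq_le t0' t0.
    rewrite g0; apply: (box_ball bx c0); apply: lt_le_trans cs _.
    by rewrite ler_pdivrMr// ler_peMr ?ler1n// ltW// (box_s bx).
  - move=> r t /andP[_ rt] Et q /andP[q0 qr]; apply: Et; rewrite q0.
    exact: le_trans qr rt.
  - move=> t tb Et; have Nt : N (g t) by apply: Et; case/andP: tb => ->; rewrite lexx.
    have lts : nrm (c (g t) - c p) < s.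
      apply: le_lt_trans (nrm_trans _ (c (u z0)) _) _; rewrite (splitr s).
      apply: ler_ltD cs; apply: le_trans (mv t tb Et) _; apply: le_trans kd.
      apply: ler_wpM2l; first by rewrite mulr_ge0.
      exact: le_trans (ty t tb) (ltW zd).
    have := cmap_near (box_sub bx Nt) (_ : 0 < s - nrm (c (g t) - c p)).
    rewrite subr_gt0 => /(_ lts) near_gt.
    have : \forall r \near t, N (g r).
      apply: (gc t); apply: filterS near_gt => q [cq qt]; apply: (box_ball bx cq).
      apply: le_lt_trans (nrm_trans _ (c (g t)) _) _.
      by move: qt; rewrite ltrBrDr.
    move=> /nbhs_ballP[d' /= d'0 hd']; exists (d' / 2); first by rewrite divr_gt0.
    move=> r /andP[r0 rt]; have [rt'|tr] := leP r t; first by apply: Et; rewrite r0.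
    apply: hd'; rewrite -ball_normE /= distrC ger0_norm ?subr_ge0 ?(ltW tr)//.
    by clear -rt d'0; lra.
  - move=> t /andP[t0 t1] Et q /andP[q0 qt].
    have [qt'|tq] := ltP q t; first by apply: (Et q); rewrite ?q0 ?lexx.
    have {tq}-> : q = t by apply/eqP; rewrite eq_le qt tq.
    have gt : g r @[r --> t^'-] --> g t by apply: cvg_within_filter; exact: gc.
    have Nr : \forall r \near t^'-, N (g r).
      near=> r; have r0 : 0 <= r by near: r; exact: nbhs_left_ge.
      apply: (Et r); last by rewrite lexx r0.
      by apply/andP; split=> //; near: r; exact: nbhs_left_lt.
    exact: (@closed_cvg _ _ _ _ g N (box_closed bx) Nr _ gt).
have g1 : g 1 = u z by rewrite /g mul1r addrC subrK.
have b1 : 0 <= (1 : R) <= 1 by rewrite ler01 lexx.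
split; first by rewrite -g1; apply: E1; exact: b1.
by have := mv 1 b1 E1; rewrite g1 mul1r.
Unshelve. all: by end_near. Qed.

(** Around each point of M, [stay] confines all curves of speed at most [k] to a small box for a
    common time; compactness makes this time independent of the point. *)
Lemma speed_equicontinuous (M_compact : compact [set: M]) U (k : R) : entourage U -> 0 < k ->
  exists2 d : R, 0 < d & forall (u : holomap R[i] X) z0,
    (forall z, nrm (z - z0) < d -> speed u z <= k) ->
    forall z, nrm (z - z0) < d -> U (u z0, u z).
Proof.
move=> eU k0.
pose P (d : R) (q : M) := forall (u : holomap R[i] X) z0, u z0 = q ->
  (forall z, nrm (z - z0) < d -> speed u z <= k) ->
  forall z, nrm (z - z0) < d -> U (q, u z).
have : \forall d \near 0^'+, [set: M] `<=` P d.
  move/compact_near_coveringP : M_compact; apply => p _.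
  have [c [ac cp]] := atlas_cover X p.
  have eV := entourage_split_ent eU.
  have Up : nbhs p [set q | split_ent U (p, q) /\ split_ent U (q, p)].
    apply: filterI.
      by apply: filterS (nbhs_entourage p eV) => q /xsectionP.
    by apply: filterS (nbhs_entourage p (entourage_inv eV)) => q /xsectionP.
  have [N [s [l [L [B [bx NU]]]]]] := box_exists ac cp Up.
  have s0 := box_s bx; have l0 := box_l bx.
  have s20 : 0 < s / 2 by rewrite divr_gt0.
  (* [s * l / (4 * k)] is the largest radius with [2 * (k / l) * d <= s / 2]. *)
  exists ([set q | cdom c q /\ nrm (c q - c p) < s / 2], [set d | 0 < d /\ d <= s * l / (4 * k)]).
    split=> /=; first exact: cmap_near.
    near=> d; split => //; near: d; apply: nbhs_right_le.
    by rewrite divr_gt0 ?mulr_gt0.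
  move=> [q d] /= [[cq qs] [d0 dk]] u z0 uq us z zd.
  have cu : cdom c (u z0) by rewrite uq.
  have cs : nrm (c (u z0) - c p) < s / 2 by rewrite uq.
  have kd : 2 * (k / l) * d <= s / 2.
    rewrite ler_pdivlMr ?mulr_gt0// in dk.
    have -> : 2 * (k / l) * d = d * (4 * k) / (2 * l) by field; rewrite gt_eqF.
    rewrite ler_pdivrMr ?mulr_gt0//; apply: le_trans dk _.
    by rewrite le_eqVlt; apply/orP; left; apply/eqP; field.
  have [Nz _] := stay bx cu cs (ltW k0) us kd zd.
  have Nq : N q by apply: (box_ball bx cq); apply: lt_le_trans qs _; rewrite ler_pdivrMr// ler_peMr ?ler1n// ltW.
  have [_ h1] := NU _ Nq; have [h2 _] := NU _ Nz.
  exact: entourage_split h1 h2.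
move=> /(filterI (nbhs_right_gt 0)) /filter_ex[d [d0 hd]].
by exists d => // u z0 us z zd; exact: (hd (u z0) I u z0 erefl us z zd).
Unshelve. all: by end_near. Qed.

End curves.

(** * Brody's reparametrisation *)

(** Continuity of [u] keeps it in a box on a disc, where its coordinates are bounded; the Cauchy
    estimate on discs of half the radius bounds the derivative. *)
Lemma speed_locally_bounded (R : realType) (n : nat) (M : uniformType)
    (X : complex_manifold R n M) (h : hermitian_metric X)
    (u : holomap R[i] X) (z0 : R[i]) : exists K : R,
  \forall z \near z0, speed h u z <= K.
Proof.
have [c [ac cc]] := atlas_cover X (u z0).
have [N [s [l [L [B [bx _]]]]]] := box_exists h ac cc filterT.
have /nbhs_nrmP[r r0 rN] : \forall z \near z0, N (u z).
  by apply: (@hfun_continuous _ _ _ _ _ u z0); exact: (box_nbhs bx).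
have r20 : 0 < r / 2 by rewrite divr_gt0.
exists (L * (16 * B / (r / 2))); apply/nbhs_nrmP; exists (r / 2) => // z zr.
have Nz : N (u z) by apply: rN; apply: lt_trans zr _; rewrite ltr_pdivrMr// ltr_pMr// ltr1n.
have [D uD] := chart_hasd ac (box_sub bx Nz).
rewrite (speed_chart h ac (box_sub bx Nz) uD).
have /andP[_ ub] := box_metric bx Nz D; apply: le_trans ub _.
rewrite ler_wpM2l ?(ltW (box_L bx))//.
apply: (@cauchy_disc_rV _ _ (c \o u) z D (r / 2) B r20) uD => y yz.
have Ny : N (u y).
  by apply: rN; apply: le_lt_trans (nrm_trans _ z _) _; rewrite (splitr r) ltrD.
split; last exact: (box_bounded bx Ny).
exact: chart_hasd ac (box_sub bx Ny).
Qed.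

Lemma square_compact (R : realType) (r : R) :
  compact [set z : R[i] | `|complex.Re z| <= r /\ `|complex.Im z| <= r].
Proof.
pose F (p : R * R) : R[i] := Complex p.1 p.2.
have -> : [set z : R[i] | `|complex.Re z| <= r /\ `|complex.Im z| <= r] =
    F @` (`[- r, r] `*` `[- r, r]).
  apply/seteqP; split=> [[x y] /= [xr yr]|_ [[x y] /= [+ +] <-]].
    by exists (x, y) => //=; rewrite !in_itv /= -!ler_norml.
  by rewrite !in_itv /= -!ler_norml.
apply: continuous_compact; last by apply: compact_setX; exact: segment_compact.
apply: continuous_subspaceT => -[x y]; apply/cvg_nrmP => e e0.
have e20 : 0 < e / 2 by rewrite divr_gt0.
exists (ball x (e / 2), ball y (e / 2)); first by split; exact: nbhsx_ballx.
move=> [a b] /= []; rewrite -!ball_normE /= => ha hb.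
apply: le_lt_trans (nrm_le_ReIm _) _; rewrite /= (splitr e) distrC [`|b - y|]distrC.
exact: ltrD.
Qed.

Lemma speed_bounded (R : realType) (n : nat) (M : uniformType)
    (X : complex_manifold R n M) (h : hermitian_metric X)
    (u : holomap R[i] X) (r : R) : exists K : R,
  forall z, nrm z <= r -> speed h u z <= K.
Proof.
have := @square_compact R r.
move/compact_near_coveringP => /(_ _ +oo%R (fun K z => speed h u z <= K)).
move=> /(_ _)[].
  move=> z0 _; have [K zK] := speed_locally_bounded h u z0.
  exists ([set z | speed h u z <= K], [set K' | K <= K']).
    by split; [exact: zK|apply: nbhs_pinfty_ge; exact: num_real].
  by move=> [z K'] /= [h1 h2]; exact: le_trans h1 h2.
move=> K0 [K0r hK]; exists (K0 + 1) => z zr; apply: hK; first by rewrite ltrDl.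
by split; [exact: le_trans (Re_le_nrm z) zr|exact: le_trans (Im_le_nrm z) zr].
Qed.

(* A near-maximum of [(1/2 - |z|) * speed u z] is enough, so continuity of the speed
   is not needed. *)
Lemma brody_point (R : realType) (n : nat) (M : uniformType)
    (X : complex_manifold R n M) (h : hermitian_metric X) (u : holomap R[i] X) : 0 < speed h u 0 ->
  exists z1, [/\ nrm z1 < 1 / 2, speed h u 0 / 4 <= (1 / 2 - nrm z1) * speed h u z1 &
    forall z, nrm (z - z1) <= (1 / 2 - nrm z1) / 2 -> speed h u z <= 4 * speed h u z1].
Proof.
move=> u0.
have [K uK] := speed_bounded h u (1 / 2).
have h2 : 0 <= 1 / 2 :> R by rewrite divr_ge0.
pose E : set R := [set (1 / 2 - nrm z) * speed h u z | z in [set z | nrm z <= 1 / 2]].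
have E0 : E (1 / 2 * speed h u 0) by exists 0; rewrite /= nrm0 ?subr0.
have hE : has_sup E.
  split; first by exists (1 / 2 * speed h u 0).
  exists (1 / 2 * K) => _ [z /= zr <-].
  apply: ler_pM; [by rewrite subr_ge0|exact: len_ge0|by rewrite gerBl nrm_ge0|exact: uK].
have ub z : nrm z <= 1 / 2 -> (1 / 2 - nrm z) * speed h u z <= sup E.
  by move=> zr; apply: (ub_le_sup hE.2); exists z.
have S0 : 1 / 2 * speed h u 0 <= sup E by apply: (ub_le_sup hE.2).
have S1 : 0 < sup E by apply: lt_le_trans S0; rewrite mulr_gt0.
(* The value at [z1] exceeds half the supremum. *)
have [_ [z1 /= z1r <-] z1S] := sup_adherent (divr_gt0 S1 (ltr0n _ 2)) hE.
exists z1.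
have s1 : 0 <= speed h u z1 := len_ge0 _ _ _ _.
have z1S' : sup E < 2 * ((1 / 2 - nrm z1) * speed h u z1).
  by move: z1S; move: (_ * speed h u z1) (sup E) => a b; clear; lra.
have z1lt : nrm z1 < 1 / 2.
  rewrite lt_neqAle z1r andbT; apply/eqP => e; move: z1S'; rewrite e subrr mul0r mulr0.
  by rewrite ltNge (ltW S1).
split => //; first by move: S0 z1S'; move: (_ * speed h u z1) (sup E) (speed h u 0) => a b d; clear; lra.
move=> z zz1.
have rho0 : 0 < 1 / 2 - nrm z1 by rewrite subr_gt0.
have nz : nrm z <= nrm z1 + (1 / 2 - nrm z1) / 2.
  by have := nrmD (z - z1) z1; rewrite subrK => /le_trans; apply; rewrite addrC lerD2l.
have zr : nrm z <= 1 / 2 by apply: le_trans nz _; move: rho0; move: (nrm z1) => a; clear; lra.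
have := ub z zr.
(* The distance to the boundary at least halves, costing a factor 2; the near-maximum costs another,
   which gives the 4. *)
have : (1 / 2 - nrm z1) / 2 * speed h u z <= (1 / 2 - nrm z) * speed h u z.
  apply: ler_wpM2r; first exact: len_ge0.
  by move: nz; move: (nrm z1) (nrm z) => a b; clear; lra.
move=> /le_trans h3 /h3 {h3} /le_lt_trans /(_ z1S') /ltW.
have -> : 2 * ((1 / 2 - nrm z1) * speed h u z1) = (1 / 2 - nrm z1) / 2 * (4 * speed h u z1) by field.
by rewrite ler_pM2l// divr_gt0.
Qed.

(** [s] is the speed at the picked point. Its product with [1 / 2 - nrm z1] is at least a quarter of
    the initial length, which bounds [s] below; the control radius, half that product after
    rescaling, is at least an eighth. *)
Lemma brody_rescaling (R : realType) (n : nat) (M : uniformType)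
    (X : complex_manifold R n M) (h : hermitian_metric X)
    (V : normedModType R[i]) (f : holomap V X) (a b : V) :
  0 < len h f a b -> exists (z1 : R[i]) (s : R), [/\ nrm z1 < 1 / 2, len h f a b / 2 <= s &
    let g := curve f (a + z1 *: b) ((s^-1)%:C%C *: b) in
    speed h g 0 = 1 /\ forall z, nrm z <= len h f a b / 8 -> speed h g z <= 4].
Proof.
pose u := curve f a b.
have uE z : speed h u z = len h f (a + z *: b) b by exact: speed_curve.
have u0E : speed h u 0 = len h f a b by rewrite uE scale0r addr0.
rewrite -u0E => u0; have [z1 [z1r s1 us]] := brody_point u0.
have rho0 : 0 < 1 / 2 - nrm z1 by rewrite subr_gt0.
have s0 : 0 < speed h u z1.
  rewrite -(pmulr_rgt0 _ rho0); apply: lt_le_trans s1; exact: divr_gt0.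
have gE z : speed h (curve f (a + z1 *: b) ((speed h u z1)^-1%:C%C *: b)) z =
    (speed h u z1)^-1 * speed h u (z1 + z * (speed h u z1)^-1%:C%C).
  rewrite speed_curve lenZ ger0_norm ?invr_ge0 ?(ltW s0)//; congr (_ * _).
  by rewrite (uE (z1 + _)) scalerDl -addrA scalerA.
exists z1, (speed h u z1); split; first exact: z1r.
  rewrite ler_pdivrMr//; apply: (@le_trans _ _ (4 * ((1 / 2 - nrm z1) * speed h u z1))).
    by rewrite mulrC -ler_pdivrMr.
  rewrite mulrA [leRHS]mulrC ler_pM2r//.
  by have := nrm_ge0 z1; move: (nrm z1) => y; clear; lra.
split; first by rewrite gE mul0r addr0 mulVf// gt_eqF.
move=> z zr; rewrite gE ler_pdivrMl// [_ * 4]mulrC; apply: us.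
rewrite addrAC subrr add0r nrmM nrm_real ger0_norm ?invr_ge0 ?(ltW s0)//.
rewrite ler_pdivrMr//; apply: le_trans zr _; move: s1.
rewrite [_ / 2 * speed h u z1]mulrAC; move: (_ * speed h u z1) => y; move: (speed h u 0) => x; clear; lra.
Qed.

(** * Weights and Yosida maps *)

Section enorm.
Variables (R : realType) (m : nat).
Implicit Types (z w : 'rV[R[i]]_m).

Lemma enorm_ge0 z : 0 <= enorm z.
Proof. exact: sqrtr_ge0. Qed.

Lemma enorm_sqr z : enorm z ^+ 2 = \sum_(k < m) (complex.Re (z 0 k) ^+ 2 + complex.Im (z 0 k) ^+ 2).
Proof. by rewrite sqr_sqrtr// sumr_ge0// => k _; rewrite addr_ge0// sqr_ge0. Qed.

Lemma enormZ a z : enorm (a *: z) = nrm a * enorm z.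
Proof.
apply/eqP; rewrite -(@eqrXn2 _ 2)// ?mulr_ge0 ?enorm_ge0 ?nrm_ge0//.
rewrite exprMn !enorm_sqr mulr_sumr; apply/eqP; apply: eq_bigr => k _.
by rewrite -!nrm_sqr mxE nrmM exprMn.
Qed.

(** Cauchy-Schwarz comes from nonnegativity of the squared norm of [s z + t w] for real [s], [t], at
    [s = enorm w] and [t = - enorm z]; when one norm vanishes, other coefficients are chosen. *)
Lemma enormD z w : enorm (z + w) <= enorm z + enorm w.
Proof.
pose dot := \sum_(k < m) (complex.Re (z 0 k) * complex.Re (w 0 k)
  + complex.Im (z 0 k) * complex.Im (w 0 k)).
have dotE (s t : R) : \sum_(k < m) ((s * complex.Re (z 0 k) + t * complex.Re (w 0 k)) ^+ 2 +
    (s * complex.Im (z 0 k) + t * complex.Im (w 0 k)) ^+ 2) =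
    s ^+ 2 * enorm z ^+ 2 + 2 * s * t * dot + t ^+ 2 * enorm w ^+ 2.
  rewrite !enorm_sqr /dot !mulr_sumr -!big_split; apply: eq_bigr => k _ /=.
  ring.
have CS : dot <= enorm z * enorm w.
  have nn s t : 0 <= \sum_(k < m) ((s * complex.Re (z 0 k) + t * complex.Re (w 0 k)) ^+ 2 +
    (s * complex.Im (z 0 k) + t * complex.Im (w 0 k)) ^+ 2).
    by apply: sumr_ge0 => k _; rewrite addr_ge0// sqr_ge0.
  have [z0|z0] := eqVneq (enorm z) 0.
    rewrite z0 mul0r; rewrite leNgt; apply/negP => d0.
    have := nn (- (enorm w ^+ 2 + 1)) dot; rewrite dotE z0 expr0n /= mulr0 add0r.
    have -> : 2 * - (enorm w ^+ 2 + 1) * dot * dot + dot ^+ 2 * enorm w ^+ 2 =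
      - ((enorm w ^+ 2 + 2) * dot ^+ 2) by ring.
    rewrite oppr_ge0 leNgt mulr_gt0 ?exprn_gt0//.
    by rewrite ltr_wpDl ?sqr_ge0.
  have [w0|w0] := eqVneq (enorm w) 0.
    rewrite w0 mulr0; rewrite leNgt; apply/negP => d0.
    have := nn dot (- (enorm z ^+ 2 + 1)); rewrite dotE w0 expr0n /= mulr0 addr0.
    have -> : dot ^+ 2 * enorm z ^+ 2 + 2 * dot * - (enorm z ^+ 2 + 1) * dot =
      - ((enorm z ^+ 2 + 2) * dot ^+ 2) by ring.
    rewrite oppr_ge0 leNgt mulr_gt0 ?exprn_gt0//.
    by rewrite ltr_wpDl ?sqr_ge0.
  have := nn (enorm w) (- enorm z); rewrite dotE.
  have -> : enorm w ^+ 2 * enorm z ^+ 2 + 2 * enorm w * - enorm z * dot + (- enorm z) ^+ 2 * enorm w ^+ 2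
    = 2 * (enorm z * enorm w) * (enorm z * enorm w - dot) by ring.
  rewrite pmulr_rge0 ?subr_ge0// mulr_gt0// mulr_gt0// lt_neqAle eq_sym ?z0 ?w0 enorm_ge0//.
rewrite -(ler_pXn2r (_ : 0 < 2)%N)// ?nnegrE ?addr_ge0 ?enorm_ge0//.
have -> : enorm (z + w) ^+ 2 = enorm z ^+ 2 + 2 * dot + enorm w ^+ 2.
  have e : enorm z ^+ 2 + 2 * dot + enorm w ^+ 2 =
      1 ^+ 2 * enorm z ^+ 2 + 2 * 1 * 1 * dot + 1 ^+ 2 * enorm w ^+ 2 by ring.
  rewrite e -dotE enorm_sqr; apply: eq_bigr => k _.
  by rewrite !mul1r mxE !raddfD.
by rewrite sqrrD; move: CS; move: (_ * enorm w) (enorm z ^+ 2) (enorm w ^+ 2) => a b c; clear; lra.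
Qed.

Lemma enorm_dist z w : `|enorm (z + w) - enorm z| <= enorm w.
Proof.
rewrite ler_norml; apply/andP; split; last by rewrite lerBlDl enormD.
have := enormD (z + w) (- 1 *: w); rewrite enormZ nrmN nrm1 mul1r scaleN1r addrK.
by move: (enorm (z + w)) (enorm z) (enorm w) => a b c; clear; lra.
Qed.

End enorm.

Section weight.
Variable R : realType.

(** The constant 1 matches the radius 1/2: after a move by at most half the weight, at least half of
    it remains. *)
Lemma weight_lipschitz (phi : R -> R) : admissible_weight phi ->
  forall a b : R, 0 < a -> 0 < b -> `|phi a - phi b| <= `|a - b|.
Proof.
case=> _ [C [C0 C1 phiC]] _.
have lt a b : 0 < a -> a < b -> `|phi a - phi b| <= `|a - b|.
  move=> a0 ab; have : (`|(phi a - phi b) / (a - b)|%:E <= C%:E)%E.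
    apply: le_trans (phiC a a0); apply: ereal_sup_ubound.
    by exists (a, b) => //=; rewrite lexx.
  rewrite lee_fin normf_div ler_pdivrMr ?normr_gt0 ?subr_eq0 ?lt_eqF// => /le_trans; apply.
  by rewrite ler_piMl.
move=> a b a0 b0; have [ab|ba|->] := ltgtP a b; first exact: lt.
  by rewrite distrC [leRHS]distrC; exact: lt.
by rewrite !subrr.
Qed.

(** A move by half the weight from norm [t] thus leaves norm at least [(t - phi 1) / 2], which still
    tends to infinity. *)
Lemma weight_le (phi : R -> R) : admissible_weight phi ->
  forall t : R, 1 <= t -> phi t <= phi 1 + t.
Proof.
move=> aphi t t1.
have := weight_lipschitz aphi (lt_le_trans ltr01 t1) ltr01.
rewrite [`|t - 1|]ger0_norm ?subr_ge0// ler_norml => /andP[_].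
by move: (phi t) (phi 1) => a b; clear; lra.
Qed.

End weight.

Lemma not_yosida (R : realType) (m n : nat) (M : uniformType)
    (X : complex_manifold R n M) (h : hermitian_metric X) (phi : R -> R)
    (f : holomap 'rV[R[i]]_m X) : ~ yosida h phi f -> forall A K : R, exists z xi : 'rV[R[i]]_m,
  [/\ A <= enorm z, enorm xi = 1 & K < phi (enorm z) * len h f z xi].
Proof.
move=> ny A K; apply/not_existsP => no; apply: ny; rewrite /yosida /=.
apply: (@le_lt_trans _ _ K%:E); last exact: ltry.
pose S : set ('rV[R[i]]_m * 'rV[R[i]]_m) := [set zx | A <= enorm zx.1 /\ enorm zx.2 = 1].
apply: (@le_trans _ _ (ereal_sup [set (phi (enorm zx.1) *
   tangent_length h (differential f zx.1 zx.2))%:E | zx in S])).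
  by apply: ereal_inf_lbound; exists S => //; exists A.
apply: ge_ereal_sup => _ [[z xi] /= [zA x1] <-]; rewrite lee_fin leNgt; apply/negP => Kl.
by apply: (no z); exists xi.
Qed.

Lemma yosidaP (R : realType) (m n : nat) (M : uniformType)
    (X : complex_manifold R n M) (h : hermitian_metric X) (phi : R -> R)
    (f : holomap 'rV[R[i]]_m X) : yosida h phi f -> exists A K : R, forall z xi : 'rV[R[i]]_m,
  A <= enorm z -> enorm xi = 1 -> phi (enorm z) * len h f z xi <= K.
Proof.
rewrite /yosida /= => /ereal_inf_lt[_ [S [A _ AS] <-] sK].
have [K SK] : exists K : R, (ereal_sup [set (phi (enorm zx.1) *
   tangent_length h (differential f zx.1 zx.2))%:E | zx in S] <= K%:E)%E.
  move: sK; case: (ereal_sup _) => [r _|//|_]; first by exists r.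
  by exists 0; exact: leNye.
exists A, K => z xi zA x1; rewrite -lee_fin; apply: le_trans SK.
by apply: ereal_sup_ubound; exists (z, xi) => //; apply: AS.
Qed.

(** All limits are replaced by explicit bounds in [j], so that choice over [j] produces the
    sequences. *)
Lemma zalcman_step (R : realType) (m n : nat) (M : uniformType)
    (X : complex_manifold R n M) (h : hermitian_metric X) (phi : R -> R)
    (f : holomap 'rV[R[i]]_m X) :
  admissible_weight phi -> ~ yosida h phi f -> forall j : nat,
  exists z xi : 'rV[R[i]]_m, exists rho : R,
  [/\ 0 < rho < 1, rho <= j.+1%:R^-1, j%:R <= enorm z, enorm xi = 1 &
    let g := curve f z ((rho * phi (enorm z))%:C%C *: xi) in
    speed h g 0 = 1 /\ forall z, nrm z <= j%:R -> speed h g z <= 4].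
Proof.
move=> phi_adm ny j.
have phi0 : forall r, 0 <= r -> 0 < phi r by case: phi_adm.
pose t : R := j%:R + 2.
have t2 : 2 <= t by rewrite lerDr.
have p1 : 0 < phi 1 by apply: phi0.
(* The first threshold leaves norm at least [t] after recentring; the second yields [s > 4 * t] and
   a control radius above [t]. *)
have [z [xi [zA x1 Kl]]] := not_yosida ny (2 * t + phi 1) (8 * t).
set e := enorm z in zA Kl.
have e1 : 1 <= e by apply: le_trans zA; move: p1 t2; move: (t) (phi 1) => a b; clear; lra.
have e0 : 0 < e by apply: lt_le_trans e1.
have pe : 0 < phi e by apply: phi0; exact: ltW.
pose b := (phi e)%:C%C *: xi.
have lb : len h f z b = phi e * len h f z xi by rewrite lenZ gtr0_norm.
rewrite -lb in Kl.
have lb0 : 0 < len h f z b.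
  by apply: lt_trans Kl; move: t2; move: (t) => a; clear; lra.
have [z1 [s [z1r ls [g0 gz]]]] := brody_rescaling lb0.
have s4 : 4 * t < s by move: ls Kl; move: (len _ _ _ _) (t) => u v; clear; lra.
have s0 : 0 < s by move: s4 t2; move: (t) => v; clear; lra.
pose w := z + z1 *: b; pose e' := enorm w.
have dw : `|e' - e| <= phi e / 2.
  apply: le_trans (enorm_dist _ _) _.
  rewrite !enormZ x1 mulr1 nrm_real gtr0_norm// mulrC ler_wpM2l ?(ltW pe)//.
  by move: z1r; move: (nrm z1) => a; clear; lra.
have pele : phi e <= phi 1 + e := weight_le phi_adm e1.
have e't : j%:R + 1 <= e'.
  have -> : (j%:R + 1 : R) = t - 1 by rewrite /t; ring.
  move: dw pele zA; rewrite ler_norml => /andP[+ _].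
  by move: (e') (e) (t) (phi e) (phi 1) => a c d p q; clear; lra.
have e'0 : 0 < e' by apply: lt_le_trans e't; rewrite ltr_wpDl.
have pe' : phi e / 2 <= phi e'.
  have := weight_lipschitz phi_adm e'0 e0; move=> /le_trans /(_ dw); rewrite ler_norml.
  by move=> /andP[+ _]; move: (phi e') (phi e) => a c; clear; lra.
have pe'0 : 0 < phi e' by apply: lt_le_trans pe'; rewrite divr_gt0.
have rho_le : phi e / (s * phi e') <= t^-1.
  rewrite ler_pdivrMr ?mulr_gt0// mulrC ler_pdivlMr; last by apply: lt_le_trans t2.
  apply: (@le_trans _ _ (2 * phi e' * t)).
    by rewrite ler_wpM2r; [|apply: le_trans t2|rewrite mulrC -ler_pdivrMr].
  rewrite mulrAC ler_wpM2r// ?(ltW pe'0)//; move: s4 t2; move: (t) => v; clear; lra.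
(* The weight at the new centre [w] cancels, leaving the step [phi e / s] of the rescaled curve; as
   [phi e'] is at least [phi e / 2], this scale is at most [2 / s]. *)
exists w, xi, (phi e / (s * phi e')).
have j1 : (j.+1%:R : R) = t - 1 by rewrite /t -natr1; ring.
split.
- rewrite divr_gt0 ?mulr_gt0//=; apply: le_lt_trans rho_le _.
  by rewrite invf_lt1; move: t2; move: (t) => v; clear; lra.
- apply: le_trans rho_le _; rewrite j1 lef_pV2 ?posrE; move: t2; move: (t) => v; clear; lra.
- by apply: le_trans e't; rewrite lerDl.
- exact: x1.
have -> : (phi e / (s * phi e') * phi (enorm w))%:C%C *: xi = s^-1%:C%C *: b.
  rewrite /b scalerA -rmorphM /= -/e'; congr (_%:C%C *: _).
  by field; rewrite !gt_eqF.
split; first exact: g0.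
move=> y yj; apply: gz; apply: le_trans yj _.
rewrite ler_pdivlMr//; move: Kl; rewrite /t; move: (len _ _ _ _) (j%:R) => u v; clear; lra.
Qed.

(** * Extraction of a convergent subsequence *)

Lemma complex_dense (R : realType) : exists d : nat -> R[i],
  forall (x : R[i]) (e : R), 0 < e -> exists i, nrm (d i - x) < e.
Proof.
(* Codes that decode to no pair of rationals get the harmless value 0. *)
pose d (i : nat) : R[i] := if @unpickle (rat * rat)%type i is Some q
  then Complex (ratr q.1) (ratr q.2) else 0.
exists d => -[x y] e e0; have e20 : 0 < e / 2 by rewrite divr_gt0.
have near_rat (t : R) : exists q : rat, `|ratr q - t| < e / 2.
  have [|q] := @rat_in_itvoo R (t - e / 2) (t + e / 2).
    by apply: lt_trans (_ : _ < t) _; [rewrite gtrBl|rewrite ltrDl].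
  by rewrite in_itv /= => qt; exists q; rewrite ltr_distl.
have [p xp] := near_rat x; have [q yq] := near_rat y.
exists (pickle (p, q)); rewrite /d pickleK /=.
apply: le_lt_trans (nrm_le_ReIm _) _; rewrite (splitr e) /=; exact: ltrD.
Qed.

Section subsequence.
Variables (T : topologicalType) (M : uniformType).
Hypotheses (M_compact : compact [set: M]) (M_sc : @second_countable M).
Variables (d : nat -> T) (G : nat -> T -> M).
Hypothesis d_dense : forall (x : T) A, nbhs x A -> exists i, A (d i).
Hypothesis G_equi : forall x U, entourage U ->
  \forall y \near x, forall j, U (G j x, G j y).

Lemma cluster_function : exists g : T -> M,
  forall (A : set {ptws T -> M}) J, nbhs (g : {ptws T -> M}) A ->
    exists2 j, (J <= j)%N & A (G j).
Proof.
have := @tychonoff T (fun=> M) (fun=> setT) (fun=> M_compact).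
move=> /(_ ((G : nat -> {ptws T -> M}) @ \oo) _)[].
  by apply: filterE => f i.
move=> g [_ cg]; exists g => A J gA.
have [|w [[j Jj <-] Aw]] := cg ([set w | exists2 j, (J <= j)%N & G j = w]) A _ gA.
  by exists J => // j Jj; exists j.
by exists j.
Qed.

(** The cluster point inherits equicontinuity. A diagonal choice gives convergence on the dense
    sequence; equicontinuity spreads it to all points and upgrades it to compact convergence. *)
Lemma equicontinuous_subsequence : exists (s : nat -> nat) (g : T -> M),
  [/\ forall k, (k <= s k)%N,
      {family compact, (fun k => G (s k)) @ \oo --> g},
      forall x, G (s k) x @[k --> \oo] --> g x & continuous g].
Proof.
have [g gP] := cluster_function.
have gF : Filter (nbhs (g : {ptws T -> M})) by exact: nbhs_pfilter.
have g_near x U : entourage U -> \forall w \near (g : {ptws T -> M}), U (g x, w x).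
  move=> eU; have gU : nbhs (g : {ptws T -> M}) (@proj T (fun=> M) x @^-1` xsection U (g x)).
    exact: (@proj_continuous T (fun=> M) x g _ (nbhs_entourage (g x) eU)).
  by apply: filterS gU => w /= /xsectionP.
have g_equi x U : entourage U -> \forall y \near x, U (g x, g y).
  move=> eU; have eV := entourage_split_ent eU; have eW := entourage_split_ent eV.
  apply: filterS (G_equi x eW) => y Gy.
  have [j _ [h1 h2]] := gP _ 0%N (filterI (g_near x _ eW) (g_near y _ (entourage_inv eV))).
  exact: (entourage_split _ eU (entourage_split _ eV h1 (Gy j)) h2).
have [B /countable_injP[e e_inj] [Bo Bb]] := M_sc.
(* Since the code [e] is injective on the basis, there is at most one basic set per code, hence only
   finitely many conditions. *)
have pick k : exists j, (k <= j)%N /\ forall i U, (i <= k)%N -> B U -> (e U <= k)%N ->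
    U (g (d i)) -> U (G j (d i)).
  pose A (i l : nat) : set {ptws T -> M} :=
    [set w | forall U, B U -> e U = l -> U (g (d i)) -> U (w (d i))].
  have gA i l : nbhs (g : {ptws T -> M}) (A i l).
    have [[U [BU eU Ug]]|no] := pselect (exists U, [/\ B U, e U = l & U (g (d i))]); last first.
      by apply: filterE => w U BU eU Ug; exfalso; apply: no; exists U.
    have Un : nbhs (g (d i)) U by apply: open_nbhs_nbhs; split=> //; exact: Bo.
    have gU : nbhs (g : {ptws T -> M}) (@proj T (fun=> M) (d i) @^-1` U).
      exact: (@proj_continuous T (fun=> M) (d i) g U Un).
    apply: filterS gU => w /= Uw U' BU' eU' _.
    by rewrite (e_inj U' U) ?inE// eU eU'.
  have : \forall w \near (g : {ptws T -> M}), forall i l : 'I_k.+1, A i l w.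
    by apply: (@filter_forall _ _ _ _ gF) => i; apply: (@filter_forall _ _ _ _ gF) => l; exact: gA.
  move=> /(gP _ k)[j kj Gj]; exists j; split => // i U ik BU eU Ug.
  by have := Gj (inord i) (inord (e U)) U BU; rewrite !inordK//; exact.
have [s sP] := choice pick.
have s_dense i : G (s k) (d i) @[k --> \oo] --> g (d i).
  move=> A /(Bb (g (d i)))[U [BU Ug] UA].
  exists (maxn i (e U)) => // k /=; rewrite geq_max => /andP[ik ek].
  by apply: UA; apply: (sP k).2.
have s_cvg x : G (s k) x @[k --> \oo] --> g x.
  apply/cvg_app_entourageP => U eU.
  have eV := entourage_split_ent eU; have eW := entourage_split_ent eV.
  have [i [Gi gi]] := d_dense (filterI (G_equi x (entourage_inv eV)) (g_equi x _ eW)).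
  have := s_dense i => /cvg_app_entourageP /(_ _ eW); apply: filterS => k Gk.
  exact: (entourage_split _ eU (entourage_split _ eV gi Gk) (Gi (s k))).
exists s, g; split=> //; first by move=> k; case: (sP k).
  (* [pointwise_compact_cvg] is stated for pointed spaces only. *)
  pose Mp : puniformType := HB.pack M (isPointed.Build M (g (d 0%N))).
  apply/(@pointwise_compact_cvg T Mp); last by apply/pointwise_cvgP.
  apply/near_powerset_filter_fromP; first exact: equicontinuous_subset_id.
  exists (range G); last by move=> x U eU; apply: filterS (G_equi x eU) => y Gy _ [j _ <-].
  by exists 0%N => // k _; exists (s k).
by move=> x; apply/cvg_app_entourageP => U eU; exact: g_equi.
Qed.

End subsequence.

(** * Limits of holomorphic curves *)

Section limit.
Variables (R : realType) (n : nat) (M : uniformType).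
Variables (X : complex_manifold R n M) (h : hermitian_metric X).
Variables (G : nat -> holomap R[i] X) (g : R[i] -> M).
Hypothesis Gg : forall x, G j x @[j --> \oo] --> g x.

(** Convergence at [z0] and the speed bound hold all late curves in one box on a common disc, and
    the limit too, the box being closed; Weierstrass' theorem then applies in the chart. *)
Lemma limit_chart (z0 : R[i]) (k r : R) c : 0 < k -> 0 < r ->
  (\forall j \near \oo, forall z, nrm (z - z0) < r -> speed h (G j) z <= k) ->
  atlas X c -> cdom c (g z0) ->
  exists2 D, hasd (c \o g) z0 D & forall e : R, 0 < e -> \forall j \near \oo,
     cdom c (G j z0) /\ nrm ('d (c \o G j) z0 1 - D) < e.
Proof.
move=> k0 r0 Gk ac cg.
have [N [s [l [L [B [bx _]]]]]] := box_exists h ac cg filterT.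
have s0 := box_s bx; have l0 := box_l bx.
have GgP x (P : set M) : nbhs (g x) P -> \forall j \near \oo, P (G j x) by exact: Gg.
have s20 : 0 < s / 2 by rewrite divr_gt0.
pose d := Num.min r (s * l / (4 * k)).
have d0 : 0 < d by rewrite lt_min r0 divr_gt0 ?mulr_gt0.
have dr : d <= r by rewrite ge_min lexx.
have kd : 2 * (k / l) * d <= s / 2.
  have : d <= s * l / (4 * k) by rewrite ge_min lexx orbT.
  rewrite ler_pdivlMr ?mulr_gt0// => dk.
  have -> : 2 * (k / l) * d = d * (4 * k) / (2 * l) by field; rewrite gt_eqF.
  rewrite ler_pdivrMr ?mulr_gt0//; apply: le_trans dk _.
  by rewrite le_eqVlt; apply/orP; left; apply/eqP; field.
have GN : \forall j \near \oo, forall z, nrm (z - z0) < d -> N (G j z).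
  apply: filterS2 (GgP _ _ (cmap_near cg s20)) Gk => j [cj sj] Gkj z zd.
  have Gkd y : nrm (y - z0) < d -> speed h (G j) y <= k.
    by move=> yd; apply: Gkj; exact: lt_le_trans dr.
  by have [] := stay bx cj sj (ltW k0) Gkd kd zd.
have gN z : nrm (z - z0) < d -> N (g z).
  move=> zd; apply: (@closed_cvg _ _ _ _ (fun j => G j z) N (box_closed bx) _ _ (Gg (x := z))).
  by apply: filterS GN => j; exact.
have Gd : \forall j \near \oo, cdom c (G j z0).
  by apply: filterS (GgP _ _ (cmap_near cg ltr01)) => j [].
have [||D gD GD] := @weierstrass R n (fun j => c \o G j) (fun j => 'd (c \o G j) z0 1)
    (c \o g) z0 d B d0.
- apply: filterS2 GN Gd => j GNj Gdj; split.
    by apply/hasdP; split=> //; exact: hfun_holomorphic.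
  move=> z zd; split; last exact: (box_bounded bx (GNj z zd)).
  exact: chart_hasd ac (box_sub bx (GNj z zd)).
- move=> z zd e e0; have gz := box_sub bx (gN z zd).
  by apply: filterS (GgP _ _ (cmap_near gz e0)) => j [].
by exists D => // e e0; apply: filterS2 Gd (GD e e0).
Qed.

End limit.

Lemma speed_tangent_bound (R : realType) (n : nat) (M : uniformType)
    (X : complex_manifold R n M) (h : hermitian_metric X) p c N s l L B
    (u : holomap R[i] X) (z : R[i]) :
  box h p c N s l L B -> N (u z) ->
  l * nrm ('d (c \o u) z 1) <= speed h u z <= L * nrm ('d (c \o u) z 1).
Proof.
move=> bx Nz; have ac := box_atlas bx; have cz := box_sub bx Nz.
have uD : hasd (c \o u) z ('d (c \o u) z 1).
  by apply/hasdP; split=> //; exact: hfun_holomorphic.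
by rewrite (speed_chart h ac cz uD); exact: (box_metric bx Nz).
Qed.

(** A constant limit has derivative 0 in a chart, so some late coordinate derivative at 0 is below
    [L^-1], and the upper metric bound makes that speed less than 1. *)
Lemma limit_nonconstant (R : realType) (n : nat) (M : uniformType)
    (X : complex_manifold R n M) (h : hermitian_metric X)
    (G : nat -> holomap R[i] X) (p : M) :
  (forall x, G j x @[j --> \oo] --> p) ->
  (\forall j \near \oo, forall z, nrm z < 1 -> speed h (G j) z <= 4) ->
  ~ \forall j \near \oo, speed h (G j) 0 = 1.
Proof.
move=> Gp G4 G1.
have GpP x (P : set M) : nbhs p P -> \forall j \near \oo, P (G j x) by exact: Gp.
have [c [ac cp]] := atlas_cover X p.
have [N [s [l [L [B [bx _]]]]]] := box_exists h ac cp filterT.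
have L0 := box_L bx.
have G4' : \forall j \near \oo, forall z, nrm (z - 0) < 1 -> speed h (G j) z <= 4.
  by apply: filterS G4 => j Gj z; rewrite subr0; exact: Gj.
have [D pD GD] := limit_chart Gp (ltr0n _ 4) ltr01 G4' ac cp.
have D0 : D = 0 by apply: hasd_unique pD _; exact: hasd_cst.
have e0 : 0 < L^-1 by rewrite invr_gt0.
have [j [[N0 s1] [_]]] := filter_ex (filterI (filterI (GpP 0 _ (box_nbhs bx)) G1) (GD _ e0)).
rewrite D0 subr0 => jL.
have /andP[_] := speed_tangent_bound bx N0.
by rewrite s1 leNgt mulrC -ltr_pdivlMr// div1r jL.
Qed.

(** The lower metric bound shows that [g] has speed 0 everywhere. With [k = 0], [stay] restricts the
    radius in no way, so one box around [g 0] contains the image of any disc and the coordinates do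
    not move. *)
Lemma limit_constant (R : realType) (n : nat) (M : uniformType)
    (X : complex_manifold R n M) (h : hermitian_metric X)
    (G : nat -> holomap R[i] X) (g : holomap R[i] X) :
  (forall x, G j x @[j --> \oo] --> g x) ->
  (forall r e : R, 0 < e -> \forall j \near \oo, forall z, nrm z <= r -> speed h (G j) z <= e) ->
  forall z, g z = g 0.
Proof.
move=> Gg Ge.
have GgP x (P : set M) : nbhs (g x) P -> \forall j \near \oo, P (G j x) by exact: Gg.
have g0 z0 : speed h g z0 = 0.
  have [c [ac cp]] := atlas_cover X (g z0).
  have [N [s [l [L [B [bx _]]]]]] := box_exists h ac cp filterT.
  have l0 := box_l bx.
  have G1 : \forall j \near \oo, forall z, nrm (z - z0) < 1 -> speed h (G j) z <= 1.
    apply: filterS (Ge (1 + nrm z0) 1 ltr01) => j Gj z zz0; apply: Gj.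
    by have := nrmD (z - z0) z0; rewrite subrK => /le_trans; apply; rewrite lerD2r ltW.
  have [D gD GD] := limit_chart Gg ltr01 ltr01 G1 ac cp.
  have D0 : D = 0.
    apply: nrm0_eq0; apply/eqP; rewrite eq_le nrm_ge0 andbT.
    apply/ler_addgt0Pr => e e0; rewrite add0r.
    have e20 : 0 < e / 2 by rewrite divr_gt0.
    have el0 : 0 < l * (e / 2) by rewrite mulr_gt0.
    have [j [[Nj Gj] [_ jD]]] := filter_ex (filterI (filterI (GgP z0 _ (box_nbhs bx))
       (Ge (nrm z0) _ el0)) (GD _ e20)).
    have /andP[lo _] := speed_tangent_bound bx Nj.
    have := le_trans lo (Gj z0 (lexx _)); rewrite ler_pM2l// => De.
    have := nrm_trans D ('d (c \o G j) z0 1) 0; rewrite !subr0 nrmBC => /le_trans; apply.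
    by rewrite (splitr e) lerD// ltW.
  have Ng : N (g z0) := nbhs_singleton (box_nbhs bx).
  have /hasdP[_ dE] := gD.
  have /andP[_ hi] := speed_tangent_bound bx Ng.
  apply/eqP; rewrite eq_le len_ge0 andbT; apply: le_trans hi _.
  by rewrite dE D0 nrm0 mulr0.
move=> z; have [c [ac cp]] := atlas_cover X (g 0).
have [N [s [l [L [B [bx _]]]]]] := box_exists h ac cp filterT.
have s20 : 0 < s / 2 by rewrite divr_gt0// (box_s bx).
have c0 : nrm (c (g 0) - c (g 0)) < s / 2 by rewrite subrr nrm0.
have gk y : nrm (y - 0) < nrm z + 1 -> speed h g y <= 0 by rewrite g0.
have kd : 2 * (0 / l) * (nrm z + 1) <= s / 2 by rewrite mul0r mulr0 mul0r ltW.
have [|Nz] := stay bx cp c0 (lexx 0) gk kd (z := z); first by rewrite subr0 ltrDl.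
rewrite mul0r mulr0 mul0r => cz.
have {}cz : c (g z) = c (g 0).
  by apply/eqP; rewrite -subr_eq0; apply/eqP/nrm0_eq0/eqP; rewrite eq_le cz nrm_ge0.
by rewrite -(cmapK (box_sub bx Nz)) cz cmapK.
Qed.

(** The Yosida bound holds with the weight at the moving point [w], while the curve is scaled by the
    weight at its centre; on these discs the latter is at most twice the former. *)
Lemma yosida_speed_cvg0 (R : realType) (m n : nat) (M : uniformType)
    (X : complex_manifold R n M) (h : hermitian_metric X) (phi : R -> R)
    (f : holomap 'rV[R[i]]_m X) (z xi : nat -> 'rV[R[i]]_m) (rho : nat -> R) :
  admissible_weight phi -> yosida h phi f ->
  (forall j, 0 < rho j) -> enorm (z j) @[j --> \oo] --> +oo ->
  rho j @[j --> \oo] --> (0 : R) -> (forall j, enorm (xi j) = 1) ->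
  forall r e : R, 0 < e -> \forall j \near \oo, forall y : R[i], nrm y <= r ->
    speed h (curve f (z j) ((rho j * phi (enorm (z j)))%:C%C *: xi j)) y <= e.
Proof.
move=> aphi /yosidaP[A [K fK]] rho0 zoo rhoc x1 r e e0.
have phi0 : forall t, 0 <= t -> 0 < phi t by case: aphi.
pose r' := `|r| + 1; have r'0 : 0 < r' by rewrite ltr_wpDl.
pose K' := `|K| + 1; have K'0 : 0 < K' by rewrite ltr_wpDl.
(* The first bound limits the displacement to half the weight; the second absorbs the factor 2 lost
   in comparing weights. *)
pose q := Num.min (1 / (2 * r')) (e / (2 * K')).
have q0 : 0 < q by rewrite lt_min !divr_gt0// mulr_gt0.
have rq : \forall j \near \oo, `|0 - rho j| < q by move/cvgrPdist_lt : rhoc; apply.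
(* As [enorm w] is at least [(E - phi 1) / 2], this threshold keeps it above [A]. *)
pose A' := 2 * (`|A| + 1) + phi 1.
have zA : \forall j \near \oo, A' <= enorm (z j) by move/cvgryPge : zoo; apply.
apply: filterS2 rq zA => j; rewrite sub0r normrN gtr0_norm// lt_min.
rewrite ltr_pdivlMr ?mulr_gt0// ltr_pdivlMr ?mulr_gt0// => /andP[rr rK] zA y yr.
move: (rho j) (rho0 j) rr rK => t t0 rr rK {rhoc rho0}.
set E := enorm (z j) in zA *.
have p1 : 0 < phi 1 by exact: phi0.
have E1 : 1 <= E.
  apply: le_trans zA; have nA := normr_ge0 A; move: p1 nA; rewrite /A'.
  by move: (`|A|) (phi 1) => a b; clear; lra.
have E0 : 0 < E by apply: lt_le_trans E1.
have pE : 0 < phi E by apply: phi0; exact: ltW.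
pose w := z j + y *: ((t * phi E)%:C%C *: xi j).
have yr' : nrm y <= r' by apply: le_trans yr _; apply: le_trans (ler_norm r) _; rewrite lerDl.
have dw : `|enorm w - E| <= phi E / 2.
  apply: le_trans (enorm_dist _ _) _; rewrite !enormZ x1 mulr1 nrm_real ger0_norm; last first.
    by rewrite mulr_ge0// ltW.
  rewrite mulrA [leRHS]mulrC ler_wpM2r// ?(ltW pE)//.
  apply: (@le_trans _ _ (r' * t)); first by rewrite ler_wpM2r// ltW.
  by rewrite mulrC; move: rr; rewrite mulrCA; move: (t * r') => a; clear; lra.
have pele : phi E <= phi 1 + E := weight_le aphi E1.
have wA : `|A| + 1 <= enorm w.
  move: dw pele zA; rewrite ler_norml /A' => /andP[+ _].
  move: (enorm w) (E) (phi E) (phi 1) (`|A|) => a1 a2 a3 a4 a5; clear; lra.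
have w0 : 0 < enorm w by apply: lt_le_trans wA; rewrite ltr_wpDl.
have pw : phi E / 2 <= phi (enorm w).
  have := weight_lipschitz aphi w0 E0; move=> /le_trans /(_ dw); rewrite ler_norml.
  by move=> /andP[+ _]; move: (phi E) (phi (enorm w)) => a c; clear; lra.
rewrite speed_curve lenZ ger0_norm; last by rewrite mulr_ge0// ltW.
have lK : phi (enorm w) * len h f w (xi j) <= K'.
  apply: le_trans (fK w (xi j) _ (x1 j)) _.
    by apply: le_trans wA; apply: le_trans (ler_norm A) _; rewrite lerDl.
  by apply: le_trans (ler_norm K) _; rewrite lerDl.
have l0 : 0 <= len h f w (xi j) by exact: len_ge0.
have : t * (phi E / 2 * len h f w (xi j)) <= t * K'.
  rewrite ler_wpM2l ?(ltW t0)//; apply: le_trans lK; exact: ler_wpM2r.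
rewrite -/w; move: rK; rewrite mulrCA.
have -> : t * phi E * len h f w (xi j) = 2 * (t * (phi E / 2 * len h f w (xi j))) by field.
by move: (t * K') (t * _) => u v; clear; lra.
Qed.

(** The speed of [G j] is controlled only on the disc of radius [j], so near [x] the uniform
    estimate covers all but finitely many curves; the others are handled by their own continuity. *)
Lemma curve_equicontinuous (R : realType) (n : nat) (M : uniformType)
    (X : complex_manifold R n M) (h : hermitian_metric X)
    (M_compact : compact [set: M]) (G : nat -> holomap R[i] X) :
  (forall j z, nrm z <= j%:R -> speed h (G j) z <= 4) ->
  forall (x : R[i]) U, entourage U -> \forall y \near x, forall j, U (G j x, G j y).
Proof.
move=> G4 x U eU.
have [d d0 dU] := speed_equicontinuous h M_compact eU (ltr0n R 4).
pose J := Num.bound (nrm x + d).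
have xJ : nrm x + d < J%:R.
  by apply: archi_boundP; rewrite addr_ge0 ?nrm_ge0// ltW.
have small : \forall y \near x, forall j : 'I_J, U (G j x, G j y).
  apply: (@filter_forall _ _ _ _ (nbhs_filter x)) => j.
  have := @hfun_continuous _ _ _ _ _ (G j) x; move=> /cvg_app_entourageP; exact.
have near_d : \forall y \near x, nrm (y - x) < d by apply/nbhs_nrmP; exists d.
apply: filterS2 small near_d => y yJ yd j.
have [jJ|Jj] := ltnP j J; first exact: (yJ (Ordinal jJ)).
apply: (dU (G j) x) => // z zd; apply: G4.
apply: le_trans (_ : J%:R <= _); last by rewrite ler_nat.
apply: le_trans (ltW xJ).
by have := nrmD (z - x) x; rewrite subrK => /le_trans; apply; rewrite addrC lerD2l ltW.
Qed.

(* Uniform convergence needs a uniform structure on M. A compact Hausdorff space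
   carries exactly one compatible with its topology, namely the one of the
   distance induced by the Hermitian metric. *)
Theorem theorem2p7 (R : realType) (m n : nat) (m_ge1 : (1 <= m)%N)
    (M : uniformType) (X : complex_manifold R n M) (h : hermitian_metric X)
    (M_compact : compact [set: M])
    (phi : R -> R) (phi_adm : admissible_weight phi)
    (f : holomap 'rV[R[i]]_m X) :
  ~ yosida h phi f <->
  exists (z xi : nat -> 'rV[R[i]]_m) (rho : nat -> R),
    [/\ forall j, 0 < rho j < 1,
        enorm (z j) @[j --> \oo] --> +oo,
        rho j @[j --> \oo] --> (0 : R),
        forall j, enorm (xi j) = 1 &
        exists g : holomap R[i] X,
          {family compact,
            (fun (j : nat) (zeta : R[i]) =>
               f (z j + (rho j * phi (enorm (z j)))%:C%C *: (zeta *: xi j)))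
            @ \oo --> (g : R[i] -> M)} /\
          ~ (exists p, forall zeta, g zeta = p)].
Proof.
have curveE (z xi : nat -> 'rV[R[i]]_m) (rho : nat -> R) :
    (fun (j : nat) (zeta : R[i]) =>
       f (z j + (rho j * phi (enorm (z j)))%:C%C *: (zeta *: xi j))) =
    (fun j => curve f (z j) ((rho j * phi (enorm (z j)))%:C%C *: xi j) : R[i] -> M).
  by apply/funext => j; apply/funext => y /=; rewrite !scalerA mulrC.
split.
  move=> ny.
  have /choice[z /choice[xi /choice[rho P]]] := zalcman_step phi_adm ny.
  pose G j := curve f (z j) ((rho j * phi (enorm (z j)))%:C%C *: xi j).
  have G1 j : speed h (G j) 0 = 1 by have [_ _ _ _ []] := P j.
  have G4 j y : nrm y <= j%:R -> speed h (G j) y <= 4.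
    by have [_ _ _ _ [_]] := P j; exact.
  have [d d_dense] := complex_dense R.
  have dd (x : R[i]) A : nbhs x A -> exists i, A (d i).
    by move=> /nbhs_nrmP[e e0 eA]; have [i di] := d_dense x e e0; exists i; exact: eA.
  have [s [g [sk Gfam Gg gc]]] := equicontinuous_subsequence M_compact
    (manifold_second_countable X) dd (curve_equicontinuous M_compact G4).
  (* Any fixed disc lies in the controlled one as soon as [j] exceeds [nrm z0 + |r|], because
     [j <= s j]. *)
  have G4s z0 (r : R) : \forall j \near \oo, forall y, nrm (y - z0) < r -> speed h (G (s j)) y <= 4.
    exists (Num.bound (nrm z0 + `|r|)) => // j /= Jj y yz; apply: G4.
    apply: (@le_trans _ _ (nrm z0 + `|r|)).
      have := nrmD (y - z0) z0; rewrite subrK => /le_trans; apply; rewrite addrC lerD2l.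
      exact: le_trans (ltW yz) (ler_norm r).
    have B0 : 0 <= nrm z0 + `|r| by rewrite addr_ge0// nrm_ge0.
    apply: le_trans (ltW (archi_boundP B0)) _.
    by rewrite ler_nat (leq_trans Jj (sk j)).
  have gh x c : atlas X c -> cdom c (g x) -> differentiable (c \o g) x.
    move=> ac cg.
    by have [D /hasdP[]] := limit_chart Gg (ltr0n R 4) ltr01 (G4s x 1) ac cg.
  (* [s] need not be increasing: [j <= s j] alone carries over both limits. *)
  exists (z \o s), (xi \o s), (rho \o s); split.
  - by move=> j; have [] := P (s j).
  - apply/cvgryPge => A; exists (Num.bound `|A|) => // j /= Aj.
    have [_ _ zj _ _] := P (s j); apply: le_trans zj.
    apply: le_trans (ler_norm A) _; apply: le_trans (ltW (archi_boundP (normr_ge0 A))) _.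
    by rewrite ler_nat (leq_trans Aj (sk j)).
  - apply/cvgrPdist_lt => e e0; near=> j.
    have [/andP[r0 _] rj _ _ _] := P (s j).
    rewrite sub0r normrN gtr0_norm//; apply: le_lt_trans rj _.
    apply: (@le_lt_trans _ _ j.+1%:R^-1); last by near: j; exact: near_infty_natSinv_lt (PosNum e0).
    by rewrite lef_pV2 ?posrE// ler_nat ltnS.
  - by move=> j; have [] := P (s j).
  exists (Holomap gc gh); split.
    by rewrite curveE; exact: Gfam.
  move=> [p gp].
  apply: (@limit_nonconstant _ _ _ X h (G \o s) p).
  - by move=> x; rewrite -(gp x); exact: Gg.
  - by apply: filterS (G4s 0 1) => j Gj y y1; apply: Gj; rewrite subr0.
  - by apply: nearW => j; exact: G1.
move=> [z [xi [rho [rho01 zoo rho0 xi1 [g [Gg gn]]]]]] yf; apply: gn.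
exists (g 0); rewrite curveE in Gg.
have Gg' x : curve f (z j) ((rho j * phi (enorm (z j)))%:C%C *: xi j) x @[j --> \oo] --> g x.
  have := pointwise_cvg_compact_family _ Gg; move=> /(_ _) /pointwise_cvgP; exact.
apply: (limit_constant (h := h) Gg') => r e e0.
apply: (yosida_speed_cvg0 phi_adm yf _ zoo rho0 xi1) => //.
by move=> j; have /andP[] := rho01 j.
Unshelve. all: by end_near. Qed.
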